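(* Let $p$ be an odd prime with $p\equiv 1\pmod 3$ and let $n$ be an integer with $\gcd(n,p)=1$. Let $a_1$ and $a_2$ be the two solutions other than $1$ of $x^3-1\equiv 0 \pmod p$, and let $\overline{a}_1$ denote the multiplicative inverse of $a_1$ modulo $p$. Then $$\sum_{\chi\neq\chi_0}|S_p(n;\chi)|^{2}\cdot |L(1,\chi)|=C\cdot (1+C_{a_1}+C_{\overline{a}_1}) \cdot p^2+O(p^{3/2}\cdot \ln p),$$ where the sum runs over all non-principal Dirichlet characters $\chi$ modulo $p$.
   Context: Write $e(y)=e^{2\pi i y}$. For a Dirichlet character $\chi$ modulo $p$, $S_p(n;\chi)=\sum_{a=1}^{p}\chi(a)\,e\!\left(\frac{na^3}{p}\right)$, and $L(s,\chi)=\sum_{m=1}^{\infty}\frac{\chi(m)}{m^s}$ is the Dirichlet $L$-function. $\chi_0$ is the principal character modulo $p$. The constant $C$ is $$C=\prod_{\ell}\left[1+\frac{\binom{2}{1}^2}{4^2\ell^2}+\frac{\binom{4}{2}^2}{4^4\ell^4}+\cdots+\frac{\binom{2m}{m}^2}{4^{2m}\ell^{2m}}+\cdots\right],$$ the product being over all primes $\ell$. $r$ is the multiplicative function on positive integers with $r(1)=1$ and $r(\ell^{\alpha})=\binom{2\alpha}{\alpha}/4^{\alpha}$ for every prime $\ell$ and integer $\alpha\ge 1$. For an integer $1\le t\le p-1$, $$C_t=\sum_{s\mid t}\frac{r(s)\,r(st)}{s^2t},$$ the sum being over the positive divisors $s$ of $t$. In the subscripts, residue classes modulo $p$ are represented by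 their representatives in $\{1,\dots,p-1\}$; in particular $a_1,a_2\in\{2,\dots,p-1\}$. The notation $f=O(g)$ means $|f|\le c\cdot g$ for an absolute constant $c$. *)

(* Defs.v *)
From mathcomp Require Import all_boot all_order all_algebra.
From mathcomp Require Import all_classical all_reals all_analysis.
From mathcomp Require Import complex.

Set Implicit Arguments.
Unset Strict Implicit.
Unset Printing Implicit Defensive.

Import Order.TTheory GRing.Theory Num.Theory.
Import numFieldNormedType.Exports.
Import ComplexField.Normc.

Local Open Scope classical_set_scope.
Local Open Scope complex_scope.
Local Open Scope ring_scope.

(* e(y) = exp(2 pi i y) *)
Definition e {R : realType} (y : R) : R[i] :=
  cos (2 * pi * y) +i* sin (2 * pi * y).

Definition dirichlet_character {R : realType} (q : nat) (chi : nat -> R[i])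
    : Prop :=
  [/\ chi 1%N = 1,
      forall m n, chi (m * n)%N = chi m * chi n,
      forall n, chi (n + q)%N = chi n
    & forall n, (chi n != 0) = coprime n q].

Definition principal_character {R : realType} (q : nat) : nat -> R[i] :=
  fun n => (coprime n q)%:R.

(* A finite set: chi is determined by its values on residues mod q, which are
   0 or roots of unity. *)
Definition nonprincipal_characters {R : realType} (q : nat)
    : set (nat -> R[i]) :=
  [set chi | dirichlet_character q chi /\ chi <> principal_character q].

Definition cubic_sum {R : realType} (p : nat) (n : int) (chi : nat -> R[i])
    : R[i] :=
  \sum_(1 <= a < p.+1) chi a * e (n%:~R * a%:R ^+ 3 / p%:R).

(* The series is indexed by k = m - 1; R[i]^o is R[i] with the topology given
   by its norm. *)
Definition dirichletL {R : realType} (s : R) (chi : nat -> R[i]) : R[i] :=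
  limn (series (fun k => chi k.+1 / (k.+1%:R `^ s)%:C) : nat -> R[i]^o).

Definition central_coef {R : realType} (k : nat) : R :=
  'C(k.*2, k)%:R / 4 ^+ k.

(* The Euler factor at l; its leading 1 is the term m = 0. *)
Definition euler_factor {R : realType} (l : nat) : R :=
  limn (series (fun m => 'C(m.*2, m)%:R ^+ 2
                         / (4 ^+ m.*2 * l%:R ^+ m.*2) : R)).

Definition constC {R : realType} : R :=
  limn (fun N => \prod_(0 <= l < N | prime l) euler_factor l : R).

Definition r {R : realType} (n : nat) : R :=
  \prod_(l <- primes n) central_coef (logn l n).

Lemma r1 (R : realType) : r 1 = 1 :> R.
Proof. by rewrite /r big_nil. Qed.

Lemma r_prime_power (R : realType) (l k : nat) :
  prime l -> (0 < k)%N -> r (l ^ k) = 'C(k.*2, k)%:R / 4 ^+ k :> R.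
Proof.
by move=> lP k0; rewrite /r primesX// primes_prime// big_seq1 pfactorK.
Qed.

Lemma r_multiplicative (R : realType) (m n : nat) :
  (0 < m)%N -> (0 < n)%N -> coprime m n -> r (m * n) = r m * r n :> R.
Proof.
move=> m0 n0 mn.
have disj l : l \in primes m -> l \in primes n -> False.
  by move=> lm ln; move: mn; rewrite coprime_has_primes// => /hasP; apply; exists l.
have log0 l k : (0 < k)%N -> l \notin primes k -> logn l k = 0%N.
  by move=> k0; rewrite -logn_gt0 lt0n negbK => /eqP.
rewrite /r (perm_big (primes m ++ primes n)); last first.
  apply: uniq_perm; rewrite ?primes_uniq//.
    rewrite cat_uniq !primes_uniq andbT /=; apply/hasPn => l ln.
    by apply/negP => lm; exact: disj lm ln.
  by move=> l; rewrite mem_cat primesM.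
rewrite big_cat /=; congr (_ * _); apply: eq_big_seq => l l_in.
- by rewrite lognM// (log0 l n)// ?addn0//; apply/negP; exact: disj.
- by rewrite lognM// (log0 l m)//; apply/negP => /disj; exact.
Qed.

Definition Csub {R : realType} (t : nat) : R :=
  \sum_(s <- divisors t) r s * r (s * t)%N / (s%:R ^+ 2 * t%:R).

(* Main.v *)
Require Import Defs.
From mathcomp Require Import all_boot all_order all_algebra.
From mathcomp Require Import all_classical all_reals all_analysis.
From mathcomp Require Import complex.
From mathcomp Require cyclic separable cyclotomic finfield.
From mathcomp Require Import zify ring lra.

Set Implicit Arguments.
Unset Strict Implicit.
Unset Printing Implicit Defensive.

Import Order.TTheory GRing.Theory Num.Theory.
Import numFieldNormedType.Exports.
Import ComplexField.Normc.

Local Open Scope classical_set_scope.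
Local Open Scope ring_scope.

(** Idea of the proof. The Dirichlet convolution of r with itself is 1 ([r_dirichlet_conv]),
    so D(chi), the sum over m < p of r(m) chi(m) / m, is a truncated square root of L(1, chi),
    and |L(1, chi)| should be close to |D(chi)|^2. In fact L(1, chi) - D(chi)^2 is, up to a
    tail O(1 / p), a sum over the integers p <= k < p^2 with coefficients at most 1 / k. By
    Parseval its mean square over the characters modulo p is O((ln p)^2 / p)
    ([sum_defect_sqr_le]). The fourth moment of the cubic sums S(chi) is O(p^3) in total
    ([cubic_sum_fourth_moment]), so replacing |L(1, chi)| by |D(chi)|^2 costs
    O(p^(3/2) ln p) ([approximation_moment]).

    What remains is a finite sum. Both |S(chi)|^2 and |D(chi)|^2 are Fourier transforms of
    autocorrelations K and T on the units modulo p ([mult_transform_sqr]), so the sum of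
    their product over all chi is p - 1 times the sum over a of K(a) T(a)
    ([fourth_moment]). Here K(a) is the sum over x != 0 of e(n (a^3 - 1) x^3 / p): it equals
    p - 1 when a^3 = 1 and is O(p^(1/2)) otherwise, which follows from an averaging argument
    ([cubic_gauss_le]). As the T(a) are nonnegative with sum O(ln p), the a with a^3 != 1
    contribute O(p^(3/2) ln p). The term a = 1 is (p - 1)^2 times the sum of r(m)^2 / m^2
    over m < p, which is constC p^2 + O(p) by the Euler product ([constC_bounds]).

    The two nontrivial cube roots of unity contribute nothing of larger order: if x = a y
    with a^2 + a + 1 = 0, then p divides x^2 + x y + y^2, so x + y is at least p^(1/2)
    ([sqrt_le_cube_root_pair]), and T(a) = O(ln p / p^(1/2)). For the same reason the
    representatives of these roots are at least p^(1/2) / 2, and the terms C_a of the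
    statement, which are O(1 / a), are absorbed by the error term. *)

(** * Elementary sums *)

(** This is ln (1 - x) <= - x at x = 1 / (n + 1). *)
Lemma inv_succ_le_ln_diff (R : realType) (n : nat) : (0 < n)%N ->
  n.+1%:R^-1 <= ln n.+1%:R - ln n%:R :> R.
Proof.
move=> n0; have n0' : (0 : R) < n%:R by rewrite ltr0n.
have n1' : (0 : R) < n.+1%:R by rewrite ltr0n.
have := @le_ln1Dx R (- n.+1%:R^-1).
have -> : 1 + - n.+1%:R^-1 = n%:R / n.+1%:R :> R.
  by rewrite -natr1; field; rewrite natr1 gt_eqF.
rewrite ltrN2 invf_lt1// ltr1n ltnS => /(_ n0).
by rewrite ln_div ?posrE// => le_ln; rewrite -lerN2 opprB.
Qed.

Lemma harmonic_le_ln (R : realType) (n : nat) : (0 < n)%N ->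
  \sum_(1 <= k < n.+1) k%:R^-1 <= 1 + ln n%:R :> R.
Proof.
elim: n => // -[_ _|n IH _]; first by rewrite big_nat1 ln1 invr1 addr0.
rewrite big_nat_recr//= (le_trans (lerD (IH isT) (inv_succ_le_ln_diff R _)))//; lra.
Qed.

(** Telescoping, since 1 / k^2 <= 2 / (k (k + 1)) for k >= 1. *)
Lemma sum_inv_sqr_le (R : realType) (m n : nat) : (0 < m)%N ->
  \sum_(m <= k < n) k%:R ^- 2 <= 2 / m%:R :> R.
Proof.
move=> m0; have [mn|nm] := leqP m n; last first.
  by rewrite big_geq ?(ltnW nm)// divr_ge0.
suff : \sum_(m <= k < n) k%:R ^- 2 <= 2 / m%:R - 2 / n%:R :> R.
  by move=> /le_trans; apply; rewrite gerBl divr_ge0.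
elim: n mn => [|n IH]; first by rewrite leqn0 gt_eqF.
rewrite leq_eqVlt => /predU1P[<-|mn]; first by rewrite big_geq// subrr.
rewrite big_nat_recr//=; have n0 := leq_trans m0 mn.
have n0' : (1 : R) <= n%:R by rewrite ler1n.
apply: le_trans (lerD (IH mn) (lexx _)) _.
rewrite -lerBrDl.
have -> : (2 / m%:R - 2 / n.+1%:R) - (2 / m%:R - 2 / n%:R)
    = 2 / (n%:R * n.+1%:R) :> R.
  rewrite -natr1; field; apply/and3P; split; rewrite ?pnatr_eq0 -?lt0n//; lra.
rewrite -[leLHS]div1r ler_pdivrMr ?exprn_gt0//; last lra.
rewrite mulrAC ler_pdivlMr ?mulr_gt0//; try lra; rewrite -natr1 expr2; nra.
Qed.

(** * The coefficients of the square root of zeta *)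

Lemma central_coef0 (R : realType) : central_coef 0 = 1 :> R.
Proof. by rewrite /central_coef bin0 expr0 divr1. Qed.

(** The numbers 'C(2k, k) / 4^k are the Taylor coefficients of (1 - z)^(-1/2); this
    recurrence is the differential equation 2 (1 - z) f' = f of that function. *)
Lemma central_coefS (R : realType) (k : nat) :
  k.+1.*2%:R * central_coef k.+1 = k.*2.+1%:R * central_coef k :> R.
Proof.
have binS : (k.+1 * 'C(k.+1.*2, k.+1) = 2 * (k.*2.+1 * 'C(k.*2, k)))%N.
  have := mul_bin_diag k.*2.+1 k; have := mul_bin_diag k.+1.*2 k.
  have := mul_bin_down k.*2.+1 k; rewrite doubleS /=.
  have -> : (k.*2.+1 - k = k.+1)%N by lia.
  move: 'C(k.*2.+2, k.+1) 'C(k.*2, k) 'C(k.*2.+1, k) 'C(k.*2.+1, k.+1) => a b c d.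
  nia.
move: binS; move/(congr1 (fun x => x%:R : R)); rewrite !natrM => binS.
rewrite /central_coef exprS.
have -> : k.+1.*2%:R = k.+1%:R * 2 :> R by rewrite -muln2 natrM.
rewrite [LHS](_ : _ = (k.+1%:R * 'C(k.+1.*2, k.+1)%:R) * 2^-1 * (4 ^+ k)^-1).
  by rewrite binS; field.
by field.
Qed.

Lemma central_coef_ge0 (R : realType) (k : nat) : 0 <= central_coef k :> R.
Proof. by rewrite /central_coef divr_ge0 ?exprn_ge0. Qed.

Lemma central_coef_le1 (R : realType) (k : nat) : central_coef k <= 1 :> R.
Proof.
elim: k => [|k IH]; first by rewrite central_coef0.
have k0 : (0 : R) < k.+1.*2%:R by rewrite ltr0n.
rewrite -(ler_pM2l k0) central_coefS ler_pM// ?central_coef_ge0// ler_nat.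
by rewrite doubleS.
Qed.

(** The coefficient form of ((1 - z)^(-1/2))^2 = (1 - z)^(-1). Weighting the sum by
    i + (k - i) = k, symmetry turns k times the sum into the sum weighted by 2i, and the
    recurrence then turns the weighted sum of order k + 1 into k + 1 times the one of
    order k. *)
Lemma central_coef_conv (R : realType) (k : nat) :
  \sum_(i < k.+1) central_coef i * central_coef (k - i) = 1 :> R.
Proof.
pose c := @central_coef R; rewrite -/c.
have cS i : i.+1.*2%:R * c i.+1 = i.*2.+1%:R * c i := central_coefS R i.
elim: k => [|k IH]; first by rewrite big_ord1 /c central_coef0 mulr1.
have sym m (a : nat -> R) : \sum_(i < m.+1) a i * (c i * c (m - i)%N)
    = \sum_(i < m.+1) a (m - i)%N * (c i * c (m - i)%N).
  rewrite (reindex_inj rev_ord_inj); apply: eq_bigr => i _ /=.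
  rewrite subSS; have im : (i <= m)%N by rewrite -ltnS.
  by rewrite subKn// [X in _ * X]mulrC.
have weighted m : m%:R * \sum_(i < m.+1) c i * c (m - i)%N
    = \sum_(i < m.+1) i.*2%:R * (c i * c (m - i)%N).
  transitivity (\sum_(i < m.+1) i%:R * (c i * c (m - i)%N)
              + \sum_(i < m.+1) (m - i)%N%:R * (c i * c (m - i)%N)).
    rewrite -big_split /= mulr_sumr; apply: eq_bigr => i _.
    by rewrite -mulrDl -natrD subnKC// -ltnS.
  rewrite -(sym m (fun i => i%:R)) -big_split /=; apply: eq_bigr => i _.
  by rewrite -mulrDl -natrD addnn.
apply: (@mulfI _ k.+1%:R); first by rewrite pnatr_eq0.
rewrite weighted big_ord_recl /= mul0r add0r.
under eq_bigr => i _ do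
  rewrite /bump add1n subSS mulrA cS -natr1 -mulrA mulrDl mul1r.
by rewrite big_split /= -weighted IH !mulr1 natr1.
Qed.

Lemma r_ge0 (R : realType) (n : nat) : 0 <= r n :> R.
Proof. by apply: prodr_ge0 => l _; exact: central_coef_ge0. Qed.

Lemma r_le1 (R : realType) (n : nat) : r n <= 1 :> R.
Proof.
by rewrite /r prodr_ile1// => l _; rewrite central_coef_ge0 central_coef_le1.
Qed.

Lemma r_prime_exp (R : realType) (l k : nat) :
  prime l -> r (l ^ k) = central_coef k :> R.
Proof.
case: k => [_|k lP]; first by rewrite expn0 r1 central_coef0.
by rewrite r_prime_power.
Qed.

(** A divisor of m n splits uniquely as gcd (d, m) gcd (d, n). *)
Lemma perm_divisors_coprime (m n : nat) : (0 < m)%N -> (0 < n)%N ->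
  coprime m n ->
  perm_eq (divisors (m * n)) [seq (a * b)%N | a <- divisors m, b <- divisors n].
Proof.
move=> m0 n0 mn; apply: uniq_perm; rewrite ?divisors_uniq//.
  apply: allpairs_uniq; rewrite ?divisors_uniq// => -[a b] [a' b'] /=.
  have cop a1 b1 : (a1 %| m)%N -> (b1 %| n)%N -> coprime a1 b1.
    by move=> am bn; apply: coprime_dvdl am (coprime_dvdr bn mn).
  move=> /allpairsP[[x y] /= [xm yn [-> ->]]] /allpairsP[[x' y'] /= [xm' yn' [-> ->]]] e.
  rewrite -!dvdn_divisors// in xm yn xm' yn'.
  have gl u v : (u %| m)%N -> (v %| n)%N -> gcdn m (u * v) = u.
    move=> um vn; rewrite Gauss_gcdl; first exact/gcdn_idPr.
    exact: coprime_dvdr vn mn.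
  have gr u v : (u %| m)%N -> (v %| n)%N -> gcdn n (u * v) = v.
    move=> um vn; rewrite Gauss_gcdr; first exact/gcdn_idPr.
    by rewrite coprime_sym; exact: coprime_dvdl um mn.
  by rewrite -(gl _ _ xm yn) e gl// -[in LHS](gr _ _ xm yn) e gr.
move=> d; rewrite -dvdn_divisors ?muln_gt0 ?m0//; apply/idP/allpairsP => [dmn|].
  exists (gcdn d m, gcdn d n); rewrite -!dvdn_divisors// !dvdn_gcdr; split => //=.
  have := mn => /eqP gmn.
  apply/eqP; rewrite eqn_dvd; apply/andP; split.
    rewrite muln_gcdl !muln_gcdr !dvdn_gcd dvdn_mulr// dvdn_mulr//=.
    by rewrite mulnC dvdn_mulr.
  rewrite Gauss_dvd ?dvdn_gcdl//.
  exact: coprime_dvdl (dvdn_gcdr _ _) (coprime_dvdr (dvdn_gcdr _ _) mn).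
by case=> -[a b] /= []; rewrite -!dvdn_divisors// => am bn ->; exact: dvdn_mul.
Qed.

Lemma perm_divisors_prime_power (l k : nat) : prime l ->
  perm_eq (divisors (l ^ k)) [seq (l ^ i)%N | i <- iota 0 k.+1].
Proof.
move=> lP; apply: uniq_perm; rewrite ?divisors_uniq//.
  rewrite map_inj_uniq ?iota_uniq// => i j; apply: expnI; exact: prime_gt1.
move=> d; rewrite -dvdn_divisors ?expn_gt0 ?prime_gt0//.
apply/dvdn_pfactor/mapP => // -[i ik ->]; exists i => //.
  by rewrite mem_iota.
by move: ik; rewrite mem_iota.
Qed.

(** Since r is multiplicative, it is enough to know this on prime powers, where it is
    [central_coef_conv]. So r is the Dirichlet coefficient sequence of the square root of
    zeta, and the twist of r by a character chi is that of the square root of L(s, chi). *)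
Lemma r_dirichlet_conv (R : realType) (n : nat) : (0 < n)%N ->
  \sum_(d <- divisors n) r d * r (n %/ d)%N = 1 :> R.
Proof.
have [N] := ubnP n; elim: N n => // N IH n; rewrite ltnS => nN n0.
have [->|n1] := eqVneq n 1%N; first by rewrite big_seq1 divn1 r1 mulr1.
have lP : prime (pdiv n) by rewrite pdiv_prime// ltn_neqAle eq_sym n1.
set l := pdiv n in lP; have l1 := prime_gt1 lP.
have [m lm En] := pfactor_coprime lP n0.
have m0 : (0 < m)%N by move: n0; rewrite En muln_gt0 => /andP[].
have k0 : (0 < logn l n)%N by rewrite logn_gt0 mem_primes lP n0 pdiv_dvd.
have cop : coprime m (l ^ logn l n) by rewrite coprime_sym coprimeXl.
have mn : (m < n)%N.
  rewrite [ltnRHS]En -[ltnLHS]muln1 ltn_pmul2l//.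
  by rewrite -(expn0 l) ltn_exp2l.
move: (logn l n) k0 cop En => k k0 cop ->.
have lk0 : (0 < l ^ k)%N by rewrite expn_gt0 prime_gt0.
rewrite (perm_big _ (perm_divisors_coprime m0 lk0 cop)) big_allpairs_dep.
rewrite -[RHS](IH m (leq_trans mn nN) m0); apply: eq_big_seq => d.
rewrite -dvdn_divisors// => dm.
rewrite (perm_big _ (perm_divisors_prime_power k lP)) big_map.
transitivity (\sum_(i <- iota 0 k.+1)
    r d * r (m %/ d)%N * (central_coef i * central_coef (k - i)) : R).
  apply: eq_big_seq => i; rewrite mem_iota add0n ltnS => /andP[_ ik].
  have d0 := dvdn_gt0 m0 dm.
  have li0 j : (0 < l ^ j)%N by rewrite expn_gt0 prime_gt0.
  have -> : (m * l ^ k %/ (d * l ^ i) = (m %/ d) * l ^ (k - i))%N.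
    rewrite -{1}(divnK dm) -{1}(subnK ik) expnD.
    have -> : (m %/ d * d * (l ^ (k - i) * l ^ i) =
      m %/ d * l ^ (k - i) * (d * l ^ i))%N by nia.
    by rewrite mulnK// muln_gt0 d0 li0.
  have copl a j : (a %| m)%N -> coprime a (l ^ j).
    move=> am; apply: coprime_dvdl am _.
    by rewrite coprime_sym coprimeXl.
  have md0 : (0 < m %/ d)%N by rewrite divn_gt0// dvdn_leq.
  rewrite !r_multiplicative ?li0// ?copl// ?dvdn_div// !r_prime_exp//.
  by rewrite mulrACA.
rewrite -mulr_sumr (_ : \sum_(i <- _) _ = 1) ?mulr1//.
by rewrite -(central_coef_conv R k) -(big_mkord xpredT
  (fun i => central_coef i * central_coef (k - i))) /index_iota subn0.
Qed.

(** * The Euler product of constC *)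

(** The coefficients of the series over all integers that has constC as Euler product. *)
Definition sqr_coef {R : realType} (m : nat) : R := r m ^+ 2 / m%:R ^+ 2.

Lemma sqr_coef_ge0 (R : realType) (m : nat) : 0 <= sqr_coef m :> R.
Proof. by rewrite /sqr_coef divr_ge0 ?sqr_ge0. Qed.

Lemma sqr_coefM (R : realType) (m n : nat) : (0 < m)%N -> (0 < n)%N ->
  coprime m n -> sqr_coef (m * n) = sqr_coef m * sqr_coef n :> R.
Proof.
move=> m0 n0 mn; rewrite /sqr_coef r_multiplicative// natrM !exprMn invfM.
by rewrite mulrACA.
Qed.

(** As 0 <= r <= 1, the tail of the series from m on is at most that of 1 / k^2. *)
Lemma sqr_coef_le_tail (R : realType) (m n : nat) : (0 < m)%N ->
  \sum_(1 <= k < n) sqr_coef k <= \sum_(1 <= k < m) sqr_coef k + 2 / m%:R :> R.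
Proof.
move=> m0; have [nm|mn] := leqP n m.
  have [n0|n0] := posnP n.
    by rewrite n0 big_geq// addr_ge0 ?divr_ge0// sumr_ge0// => k _; exact: sqr_coef_ge0.
  rewrite [in leRHS](big_cat_nat (n := n))//= -[leLHS]addr0 -addrA lerD2l.
  by rewrite addr_ge0 ?divr_ge0// sumr_ge0// => k _; exact: sqr_coef_ge0.
rewrite (big_cat_nat (n := m))//=; last exact: ltnW.
rewrite lerD2l (le_trans _ (sum_inv_sqr_le R n m0))//.
apply: ler_sum => k _; rewrite /sqr_coef -[leRHS]mul1r ler_wpM2r ?invr_ge0 ?sqr_ge0//.
by rewrite expr_le1// ?r_ge0// r_le1.
Qed.

Definition euler_partial {R : realType} (K l : nat) : R :=
  \sum_(0 <= m < K) sqr_coef (l ^ m).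

Lemma sqr_coef_prime_power (R : realType) (l m : nat) : prime l ->
  sqr_coef (l ^ m) = 'C(m.*2, m)%:R ^+ 2 / (4 ^+ m.*2 * l%:R ^+ m.*2) :> R.
Proof.
move=> lP; rewrite /sqr_coef r_prime_exp// /central_coef expr_div_n.
by rewrite natrX -!exprM muln2 invfM mulrA.
Qed.

Lemma ler_sum_sub_uniq (R : realType) (s t : seq nat) (F : nat -> R) :
  uniq s -> uniq t -> {subset s <= t} -> (forall i, 0 <= F i) ->
  \sum_(i <- s) F i <= \sum_(i <- t) F i.
Proof.
move=> us ut st F0.
have st_perm : perm_eq [seq i <- t | i \in s] s.
  apply: uniq_perm; rewrite ?filter_uniq// => i; rewrite mem_filter.
  by apply/andP/idP => [[]//|is_]; split => //; exact: st.
rewrite -(perm_big _ st_perm) big_filter [leRHS](bigID (mem s)) /=.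
by rewrite lerDl sumr_ge0.
Qed.

Lemma euler_partial_le2 (R : realType) (K l : nat) : prime l ->
  euler_partial K l <= 2 :> R.
Proof.
move=> lP.
rewrite /euler_partial -(big_map (fun i => l ^ i)%N xpredT sqr_coef).
apply: le_trans (_ : \sum_(1 <= k < (l ^ K).+1) sqr_coef k <= _).
  apply: ler_sum_sub_uniq; rewrite ?iota_uniq//.
  - by rewrite map_inj_uniq ?iota_uniq// => i j; apply: expnI; exact: prime_gt1.
  - move=> _ /mapP[i + ->]; rewrite !mem_index_iota /= => iK.
    by rewrite expn_gt0 prime_gt0// ltnS leq_exp2l ?prime_gt1// ltnW.
  - exact: sqr_coef_ge0.
apply: le_trans (sqr_coef_le_tail R _ (isT : (0 < 1)%N)) _.
by rewrite big_geq// add0r divr1.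
Qed.

Lemma cvg_euler_partial (R : realType) (l : nat) : prime l ->
  (fun K => euler_partial K l : R) @ \oo --> (euler_factor l : R).
Proof.
move=> lP; have E : (fun K => euler_partial K l : R) =
    series (fun m => 'C(m.*2, m)%:R ^+ 2 / (4 ^+ m.*2 * l%:R ^+ m.*2) : R).
  apply/funext => K; rewrite /euler_partial /series /=.
  by apply: eq_bigr => m _; exact: sqr_coef_prime_power.
rewrite /euler_factor -E.
apply: nondecreasing_is_cvgn.
  apply/nondecreasing_seqP => K.
  by rewrite /euler_partial big_nat_recr//= lerDl sqr_coef_ge0.
by exists 2 => _ [K _ <-]; exact: euler_partial_le2.
Qed.

(** Lists the integers whose prime factors are below N, each with exponent below K: the
    terms obtained when the partial Euler product is multiplied out. *)
Fixpoint smooth_seq (K N : nat) : seq nat :=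
  if N is N'.+1 then
    if prime N' then [seq (a * N' ^ k)%N | a <- smooth_seq K N', k <- iota 0 K]
    else smooth_seq K N'
  else [:: 1%N].

Lemma smooth_seq_bound (K N a l : nat) : a \in smooth_seq K N ->
  (0 < a)%N /\ (prime l -> (l %| a)%N -> (l < N)%N).
Proof.
elim: N a => [|N IH] a /=.
  by rewrite inE => /eqP ->; split=> // lP; rewrite dvdn1 => /eqP l1; rewrite l1 in lP.
case: ifPn => [NP /allpairsP[[b k] /= [/IH[b0 bN] _ ->]]|_ /IH[a0 aN]].
  split=> [|lP]; first by rewrite muln_gt0 b0 expn_gt0 prime_gt0.
  rewrite Euclid_dvdM// => /orP[/(bN lP)/ltnW//|]; rewrite Euclid_dvdX// => /andP[].
  by rewrite dvdn_prime2// => /eqP ->.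
by split=> // lP /(aN lP)/ltnW.
Qed.

Lemma smooth_seq_coprime (K N a k : nat) : prime N -> a \in smooth_seq K N ->
  coprime a (N ^ k).
Proof.
move=> NP /smooth_seq_bound aN; rewrite coprime_sym coprimeXl// prime_coprime//.
by apply/negP => /((aN N).2 NP); rewrite ltnn.
Qed.

Lemma smooth_seq_uniq (K N : nat) : uniq (smooth_seq K N).
Proof.
elim: N => //= N IH; case: ifPn => // NP.
apply: allpairs_uniq; rewrite ?iota_uniq// => -[a k] [b j].
move=> /allpairsP[[x y] /= [xs _ [-> ->]]] /allpairsP[[x' y'] /= [xs' _ [-> ->]]] /= e.
have logE z w : z \in smooth_seq K N -> logn N (z * N ^ w) = w.
  move=> zs; have z0 := (smooth_seq_bound 0 zs).1.
  have Nw0 : (0 < N ^ w)%N by rewrite expn_gt0 prime_gt0.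
  rewrite lognM// pfactorK// (_ : logn N z = 0%N)//.
  apply/eqP; rewrite -[_ == _]negbK -lt0n logn_gt0 mem_primes NP z0 /=.
  by apply/negP => /((smooth_seq_bound N zs).2 NP); rewrite ltnn.
have yE : y = y' by rewrite -(logE _ y xs) e logE.
rewrite yE in e *; congr pair; apply/eqP.
by move/eqP: e; rewrite eqn_pmul2r// expn_gt0 prime_gt0.
Qed.

Lemma mem_smooth_seq (K N m : nat) : (0 < m < K)%N ->
  (forall l, prime l -> (l %| m)%N -> (l < N)%N) -> m \in smooth_seq K N.
Proof.
elim: N m => [|N IH] m /andP[m0 mK] mN /=.
  rewrite inE; apply/negPn/negP => m1.
  have := mN (pdiv m); rewrite pdiv_prime ?pdiv_dvd//; first by move=> /(_ isT isT).
  by rewrite ltn_neqAle eq_sym m1.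
case: ifPn => NP; last first.
  apply: IH; rewrite ?m0// => l lP lm; have := mN l lP lm.
  by rewrite ltnS leq_eqVlt => /predU1P[lN|//]; rewrite lN (negPf NP) in lP.
have [a Na Em] := pfactor_coprime NP m0.
have a0 : (0 < a)%N by move: m0; rewrite Em muln_gt0 => /andP[].
have am : (a <= m)%N by rewrite [leqRHS]Em leq_pmulr// expn_gt0 prime_gt0.
apply/allpairsP; exists (a, logn N m); split => //=.
  apply: IH; first by rewrite a0 (leq_ltn_trans am).
  move=> l lP la; have /(mN l lP) : (l %| m)%N by rewrite Em dvdn_mulr.
  rewrite ltnS leq_eqVlt => /predU1P[lN|//]; move: Na.
  by rewrite prime_coprime// -lN la.
rewrite mem_iota add0n /=.
apply: leq_ltn_trans mK; apply: leq_trans (_ : N ^ logn N m <= m)%N.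
  by rewrite ltnW// ltn_expl// prime_gt1.
by rewrite [leqRHS]Em leq_pmull.
Qed.

Lemma prod_euler_partial (R : realType) (K N : nat) :
  \prod_(0 <= l < N | prime l) euler_partial K l
    = \sum_(m <- smooth_seq K N) sqr_coef m :> R.
Proof.
elim: N => [|N IH] /=.
  by rewrite big_geq// big_seq1 /sqr_coef r1 expr1n divr1.
rewrite big_mkcond big_nat_recr//= -big_mkcond /= IH; case: ifPn => NP; last by rewrite mulr1.
rewrite big_allpairs_dep mulr_suml; apply: eq_big_seq => a aN.
rewrite /euler_partial mulr_sumr /index_iota subn0; apply: eq_bigr => k _.
have Nk0 : (0 < N ^ k)%N by rewrite expn_gt0 prime_gt0.
rewrite sqr_coefM// ?(smooth_seq_bound 0 aN).1//; exact: smooth_seq_coprime aN.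
Qed.

(** Multiplied out, a partial Euler product is a sum of [sqr_coef] over distinct
    integers, which [sqr_coef_le_tail] bounds from above; and it contains every integer
    below p as soon as it reaches all primes and exponents below p. Both bounds pass to the
    limit. *)
Lemma constC_bounds (R : realType) (p : nat) : (0 < p)%N ->
  \sum_(1 <= m < p) sqr_coef m <= constC :> R /\
  constC <= \sum_(1 <= m < p) sqr_coef m + 2 / p%:R :> R.
Proof.
move=> p0; pose P N : R := \prod_(0 <= l < N | prime l) euler_factor l.
pose PK K N : R := \prod_(0 <= l < N | prime l) euler_partial K l.
(* A finite product of Euler factors is the limit of the products of their partial sums. *)
have cvgP N : PK ^~ N @ \oo --> P N.
  rewrite /PK /P; elim: N => [|N IH].
    rewrite big_geq// (_ : (fun _ => _) = cst 1); first exact: cvg_cst.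
    by apply/funext => K; rewrite big_geq.
  rewrite big_mkcond big_nat_recr//= -big_mkcond /=.
  rewrite (_ : (fun _ => _) = (fun K => \prod_(0 <= l < N | prime l) euler_partial K l *
    (if prime N then euler_partial K N else 1))); last first.
    by apply/funext => K; rewrite big_mkcond big_nat_recr//= -big_mkcond.
  apply: cvgM => //; case: ifPn => NP; first exact: cvg_euler_partial.
  exact: cvg_cst.
have le_factor K l : prime l -> euler_partial K l <= euler_factor l :> R.
  move=> lP; rewrite -(cvg_lim (@Rhausdorff R) (@cvg_euler_partial R l lP)).
  apply: (@nondecreasing_cvgn_le _ (euler_partial ^~ l)); last first.
    by apply/cvg_ex; exists (euler_factor l); exact: cvg_euler_partial.
  apply/nondecreasing_seqP => k.
  by rewrite /euler_partial big_nat_recr//= lerDl sqr_coef_ge0.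
have ge1_factor l : prime l -> 1 <= euler_factor l :> R.
  move=> lP; apply: le_trans (le_factor 1%N l lP).
  by rewrite /euler_partial big_nat1 /sqr_coef expn0 r1 expr1n divr1.
have ub N : P N <= \sum_(1 <= m < p) sqr_coef m + 2 / p%:R.
  apply: cvgr_to_le (cvgP N) _; apply: nearW => K; rewrite /PK prod_euler_partial.
  apply: le_trans (sqr_coef_le_tail R (\max_(a <- smooth_seq K N) a).+1 p0).
  apply: ler_sum_sub_uniq; rewrite ?smooth_seq_uniq ?iota_uniq//.
    move=> a aN; rewrite mem_index_iota (smooth_seq_bound 0 aN).1 /= ltnS.
    by rewrite (big_rem a)//= leq_maxl.
  exact: sqr_coef_ge0.
have ndP : nondecreasing_seq P.
  apply/nondecreasing_seqP => N; rewrite /P [leRHS]big_mkcond big_nat_recr//= -big_mkcond /=.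
  case: ifPn => NP; last by rewrite mulr1.
  rewrite ler_peMr ?ge1_factor// prodr_ge0// => l lP.
  by rewrite (le_trans ler01)// ge1_factor.
have cvP : cvgn P.
  apply: nondecreasing_is_cvgn => //.
  by exists (\sum_(1 <= m < p) sqr_coef m + 2 / p%:R) => _ [N _ <-]; exact: ub.
have -> : constC = limn P by [].
split; last by apply: limr_le => //; exact: nearW.
apply: le_trans (nondecreasing_cvgn_le ndP cvP p).
apply: (@le_trans _ _ (PK p p)).
  rewrite /PK prod_euler_partial; apply: ler_sum_sub_uniq.
  - by rewrite iota_uniq.
  - exact: smooth_seq_uniq.
  - move=> m; rewrite mem_index_iota => /andP[m0 mp].
    apply: mem_smooth_seq; first by rewrite m0.
    by move=> l _ /(dvdn_leq m0) lm; exact: leq_ltn_trans lm mp.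
  - exact: sqr_coef_ge0.
rewrite /PK /P; apply: ler_prod => l lP; rewrite le_factor// andbT.
by rewrite /euler_partial sumr_ge0// => k _; exact: sqr_coef_ge0.
Qed.

Lemma Csub_ge0 (R : realType) (t : nat) : 0 <= Csub t :> R.
Proof.
by rewrite /Csub sumr_ge0// => s _; rewrite divr_ge0 ?mulr_ge0 ?r_ge0 ?sqr_ge0.
Qed.

Lemma Csub_le (R : realType) (t : nat) : (0 < t)%N -> Csub t <= 2 / t%:R :> R.
Proof.
move=> t0; rewrite /Csub.
apply: (@le_trans _ _ (\sum_(s <- divisors t) s%:R ^- 2 / t%:R)).
  apply: ler_sum => s _; rewrite invfM ler_piMl ?mulr_ge0 ?invr_ge0 ?sqr_ge0//.
  by rewrite mulr_ile1 ?r_ge0 ?r_le1.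
rewrite -mulr_suml ler_wpM2r ?invr_ge0//.
rewrite -[leRHS]divr1; apply: le_trans (sum_inv_sqr_le R t.+1 (isT : (0 < 1)%N)).
apply: ler_sum_sub_uniq; rewrite ?divisors_uniq ?iota_uniq//.
  move=> s; rewrite -dvdn_divisors// mem_index_iota => st.
  by rewrite (dvdn_gt0 t0 st) ltnS dvdn_leq.
Qed.

(** * The characters modulo a prime *)

(** In characteristic zero 'X^n - 1 is separable, so it has n distinct roots, and a
    group of n roots of unity in a field is cyclic. *)
Lemma closed_prim_root_exists (F : numClosedFieldType) (n : nat) : (0 < n)%N ->
  exists z : F, n.-primitive_root z.
Proof.
move=> n0; pose p : {poly F} := 'X^n - 1.
have [rs Dp] := closed_field_poly_normal p.
rewrite (monicP _) ?monicXnsubC // scale1r in Dp.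
have rn1 : all n.-unity_root rs by apply/allP=> z; rewrite -root_prod_XsubC -Dp.
have sz_rs : (n < (size rs).+1)%N.
  by rewrite -(size_prod_XsubC rs id) -Dp size_XnsubC.
have [|z] := hasP (cyclic.has_prim_root n0 rn1 _ sz_rs); last by exists z.
rewrite -separable.separable_prod_XsubC -Dp cyclotomic.separable_Xn_sub_1//.
by rewrite pnatr_eq0 -lt0n.
Qed.

Lemma fermat_little_Fp (p : nat) (x : 'F_p) : prime p -> x != 0 -> x ^+ p.-1 = 1.
Proof.
move=> pP x0; apply: (mulfI x0); rewrite -exprS prednK ?prime_gt0// mulr1.
by have := finfield.expf_card x; rewrite card_Fp.
Qed.

Lemma Fp_prim_root_exists (p : nat) : prime p ->
  exists g : 'F_p, p.-1.-primitive_root g.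
Proof.
move=> pP; have p0 : (0 < p.-1)%N by rewrite -ltnS prednK ?prime_gt1 ?prime_gt0.
pose rs := [seq x <- enum 'F_p | x != 0].
have rn1 : all p.-1.-unity_root rs.
  apply/allP => x; rewrite mem_filter unity_rootE => /andP[x0 _].
  by rewrite fermat_little_Fp.
suff /hasP[g _ gP] : has p.-1.-primitive_root rs by exists g.
apply: cyclic.has_prim_root => //.
- by rewrite filter_uniq// enum_uniq.
- by rewrite /rs -rem_filter ?enum_uniq// size_rem ?mem_enum// -cardE card_Fp.
Qed.

(** X lists the Dirichlet characters modulo p without repetition, as functions on 'F_p, with
    the principal one at index 0; the third clause is the orthogonality of columns. *)
Definition is_character_table {R : realType} (p : nat)
    (X : 'I_p.-1 -> 'F_p -> R[i]) : Prop :=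
  [/\ forall j, X j 1 = 1 /\ (forall x, (X j x == 0) = (x == 0)),
      forall j x y, X j (x * y) = X j x * X j y,
      forall x, \sum_j X j x = if x == 1 then p.-1%:R else 0,
      injective X /\ (forall j : 'I_p.-1, (j : nat) = 0%N <-> X j = (fun x => (x != 0)%:R))
    & forall chi, dirichlet_character p chi ->
        exists j, chi = fun a => X j a%:R].

(** Fix a generator g of the units modulo p and a primitive root of unity w of order
    p - 1 in R[i]. The j-th character sends g^k to w^(jk). It is well defined because g and w
    have the same order, and every character is of this form because its value at g is a
    (p-1)-st root of unity. *)
Lemma character_table_exists (R : realType) (p : nat) : prime p ->
  exists X : 'I_p.-1 -> 'F_p -> R[i], is_character_table X.
Proof.
move=> pP; have n0 : (0 < p.-1)%N by rewrite -ltnS prednK ?prime_gt1 ?prime_gt0.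
have [w wP] := @closed_prim_root_exists R[i]%C _ n0.
have [g gP] := Fp_prim_root_exists pP.
have g0 : g != 0 by rewrite (prim_root_eq0 gP) -lt0n.
have /choice[lg lgP] : forall x : 'F_p, exists k, x != 0 -> x = g ^+ k.
  move=> x; have [->|x0] := eqVneq x 0; first by exists 0%N.
  have [k ->] := prim_rootP gP (fermat_little_Fp pP x0).
  by exists k.
have wg k j : g ^+ k = g ^+ j -> w ^+ k = w ^+ j.
  by move=> e; apply/eqP; rewrite (eq_prim_root_expr wP) -(eq_prim_root_expr gP) e.
have gk0 k : g ^+ k != 0 by rewrite expf_neq0.
have lgg k : w ^+ lg (g ^+ k) = w ^+ k by apply: wg; rewrite -lgP.
pose X (j : 'I_p.-1) x := if x == 0 then 0 else w ^+ lg x ^+ j.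
have w0 : w != 0 by rewrite (prim_root_eq0 wP) -lt0n.
have Xg j k : X j (g ^+ k) = w ^+ k ^+ j by rewrite /X (negPf (gk0 k)) lgg.
have X1 j : X j 1 = 1 by rewrite -(expr0 g) Xg expr0 expr1n.
exists X; split.
- move=> j; split=> // x; have [->|x0] := eqVneq x 0; rewrite /X ?eqxx//.
  rewrite (negPf x0).
  by rewrite !expf_eq0 (negPf w0) !andbF.
- move=> j x y; have [->|x0] := eqVneq x 0; first by rewrite mul0r /X eqxx mul0r.
  have [->|y0] := eqVneq y 0; first by rewrite mulr0 /X eqxx mulr0.
  by rewrite (lgP x)// (lgP y)// -exprD !Xg exprD exprMn.
- move=> x; have [->|x0] := eqVneq x 0.
    by rewrite eq_sym oner_eq0 big1// => j _; rewrite /X eqxx.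
  have [->|x1] := eqVneq x 1.
    by under eq_bigr do rewrite X1; rewrite sumr_const card_ord.
  have wx1 : w ^+ lg x != 1.
    apply: contra x1 => /eqP e; rewrite (lgP x)// -(expr0 g) (eq_prim_root_expr gP).
    by rewrite -(eq_prim_root_expr wP) e.
  rewrite /X (negPf x0); apply: (@mulfI _ (w ^+ lg x - 1)); first by rewrite subr_eq0.
  by rewrite -subrX1 mulr0 exprAC (prim_expr_order wP) expr1n subrr.
- have Xg1 j : X j g = w ^+ j by rewrite -[in LHS](expr1 g) Xg expr1.
  split=> [i j /(congr1 (fun f => f g))|j].
    rewrite !Xg1 => /eqP; rewrite (eq_prim_root_expr wP) !modn_small//.
    by move/eqP/val_inj.
  split=> [j0|Xj].
    by apply/funext => x; rewrite /X j0 expr0; case: eqVneq.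
  have := congr1 (fun f => f g) Xj; rewrite Xg1 g0.
  move/eqP; rewrite -(expr0 w) (eq_prim_root_expr wP) mod0n modn_small//.
  by move/eqP.
- move=> chi [chi1 chiM chiP chi0].
  have chi_mod a : chi (a %% p)%N = chi a.
    rewrite [in RHS](divn_eq a p); elim: (a %/ p)%N => [|k IH] //.
    by rewrite mulSn -addnA addnC chiP.
  pose psi (x : 'F_p) := chi (x : nat).
  have psiE a : psi a%:R = chi a by rewrite /psi val_Fp_nat// chi_mod.
  have psiM x y : psi (x * y) = psi x * psi y.
    by rewrite -[x]natr_Zp -[y]natr_Zp -natrM !psiE chiM.
  have psi1 : psi 1 = 1 by rewrite -[1]/(1%:R) psiE.
  have psiX k : psi (g ^+ k) = psi g ^+ k.
    by elim: k => [|k IH]; rewrite ?psi1// !exprS psiM IH.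
  have : psi g ^+ p.-1 = 1 by rewrite -psiX (prim_expr_order gP).
  move/(prim_rootP wP) => [j psig]; exists j; apply/funext => a; rewrite -psiE.
  have [->|a0] := eqVneq (a%:R : 'F_p) 0; last first.
    by rewrite (lgP _ a0) Xg psiX psig exprAC.
  rewrite -[0]/(0%:R) psiE /X eqxx; apply/eqP/negPn.
  by rewrite chi0 /coprime gcd0n; apply/negP => /eqP p1; rewrite p1 in pP.
Qed.

Lemma character_table_dirichlet (R : realType) (p : nat)
    (X : 'I_p.-1 -> 'F_p -> R[i]) j : prime p -> is_character_table X ->
  dirichlet_character p (fun a => X j a%:R).
Proof.
move=> pP [X1 XM _ _ _]; split.
- by rewrite (X1 j).1.
- by move=> m n; rewrite natrM XM.
- move=> n; rewrite natrD [p%:R](_ : _ = 0) ?addr0//.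
  by apply/eqP; rewrite -Fp_nat_mod// modnn.
- move=> n; rewrite (X1 j).2 coprime_sym prime_coprime// /dvdn -(val_Fp_nat pP).
  by rewrite -val_eqE.
Qed.

Lemma principal_character_Fp (R : realType) (p : nat) : prime p ->
  @principal_character R p = (fun a => ((a%:R : 'F_p) != 0)%:R).
Proof.
move=> pP; apply/funext => a; rewrite /principal_character coprime_sym prime_coprime//.
by rewrite /dvdn -(val_Fp_nat pP) -val_eqE.
Qed.

(** Turns the sum over a set of functions on nat into a sum over a finite index type. *)
Lemma sum_nonprincipal (R : realType) (p : nat) (X : 'I_p.-1 -> 'F_p -> R[i])
    (F : (nat -> R[i]) -> R) : prime p -> is_character_table X ->
  \sum_(chi \in nonprincipal_characters p) F chi
    = \sum_(j < p.-1 | (j : nat) != 0%N) F (fun a => X j a%:R).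
Proof.
move=> pP tX; have [X1 XM Xsum [Xinj X0] Xall] := tX.
pose h (j : 'I_p.-1) := fun a : nat => X j a%:R.
have hE i x : X i x = h i x by rewrite /h natr_Zp.
have h_inj : injective h.
  by move=> i j e; apply: Xinj; apply/funext => x; rewrite !hE e.
transitivity (\sum_(chi <- map h [seq j : 'I_p.-1 <- index_enum _ | (j : nat) != 0%N]) F chi);
  last by rewrite big_map big_filter.
rewrite [RHS]fsbig_seq ?map_inj_uniq ?filter_uniq ?index_enum_uniq//.
apply: eq_fsbigl; apply/seteqP; split => [chi [chiP chi0]|chi /= /mapP[j]].
  have [j chij] := Xall _ chiP; apply/mapP; exists j => //.
  rewrite mem_filter mem_index_enum andbT; apply/eqP => j0; apply: chi0.
  by rewrite chij principal_character_Fp// ((X0 j).1 j0).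
rewrite mem_filter => /andP[j0 _] ->; split; first exact: character_table_dirichlet.
rewrite principal_character_Fp// => e; move/eqP: j0; apply.
apply/X0; apply/funext => x.
by have := congr1 (fun f => f (x : nat)) e; rewrite /h /= natr_Zp.
Qed.

(** * Fourier analysis on the units modulo p *)

Lemma normc_ge0 (R : rcfType) (z : R[i]) : 0 <= normc z.
Proof. by case: z => a b; exact: sqrtr_ge0. Qed.

Lemma mulcJ (R : rcfType) (z : R[i]) : z * z^* = (normc z ^+ 2)%:C%C.
Proof. by rewrite -normCK rmorphXn. Qed.

Lemma normcX (R : rcfType) (z : R[i]) (n : nat) : normc (z ^+ n) = normc z ^+ n.
Proof. by elim: n => [|n IH]; rewrite ?normc1// !exprS normcM IH. Qed.

Lemma normc_real (R : rcfType) (x : R) : normc x%:C%C = `|x|.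
Proof. by rewrite /= expr0n addr0 sqrtr_sqr. Qed.

Lemma normc_sum (R : rcfType) (I : Type) (s : seq I) (P : pred I) (F : I -> R[i]) :
  normc (\sum_(i <- s | P i) F i) <= \sum_(i <- s | P i) normc (F i).
Proof.
elim/big_ind2 : _ => [|x a y b xa yb|//]; first by rewrite normc0.
by apply: le_trans (le_normcD _ _) _; exact: lerD.
Qed.

Lemma character_normc (R : realType) (p : nat) (X : 'I_p.-1 -> 'F_p -> R[i]) j x :
  prime p -> is_character_table X -> normc (X j x) = (x != 0)%:R.
Proof.
move=> pP [X1 XM _ _ _]; have [->|x0] := eqVneq x 0.
  have /eqP -> : X j 0 == 0 by rewrite (X1 j).2.
  by rewrite normc0.
have XX k : X j (x ^+ k) = X j x ^+ k.
  by elim: k => [|k IH]; rewrite ?(X1 j).1// !exprS XM IH.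
have n0 : (0 < p.-1)%N by rewrite -ltnS prednK ?prime_gt1 ?prime_gt0.
apply/eqP; rewrite -(pexpr_eq1 n0) ?normc_ge0// -normcX -XX fermat_little_Fp//.
by rewrite (X1 j).1 normc1.
Qed.

Lemma character_conj (R : realType) (p : nat) (X : 'I_p.-1 -> 'F_p -> R[i]) j x :
  prime p -> is_character_table X -> (X j x)^* = X j x^-1.
Proof.
move=> pP tX; have [X1 XM _ _ _] := tX; have [->|x0] := eqVneq x 0.
  have /eqP X0 : X j 0 == 0 by rewrite (X1 j).2.
  by rewrite invr0 X0 conjC0.
have Xx : X j x != 0 by rewrite (X1 j).2.
apply: (mulfI Xx); rewrite mulcJ character_normc// x0 expr1n -XM mulfV//.
by rewrite (X1 j).1.
Qed.

(** The Fourier transform on the group of units: characters vanish at x = 0. *)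
Definition mult_transform {R : realType} (p : nat) (X : 'I_p.-1 -> 'F_p -> R[i])
  (f : 'F_p -> R[i]) (j : 'I_p.-1) : R[i] := \sum_x f x * X j x.

Definition autocorr {R : realType} (p : nat) (f : 'F_p -> R[i]) (a : 'F_p) : R[i] :=
  \sum_(y | y != 0) f (a * y) * (f y)^*.

(** The squared modulus of a transform is the transform of an autocorrelation. *)
Lemma mult_transform_sqr (R : realType) (p : nat) (X : 'I_p.-1 -> 'F_p -> R[i])
    f j : prime p -> is_character_table X ->
  mult_transform X f j * (mult_transform X f j)^* = mult_transform X (autocorr f) j.
Proof.
move=> pP tX; have [X1 XM _ _ _] := tX.
have X0 : X j 0 = 0 by apply/eqP; rewrite (X1 j).2.
rewrite /mult_transform /autocorr rmorph_sum mulr_sumr.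
under [RHS]eq_bigr do rewrite mulr_suml.
rewrite [RHS]exchange_big /= [RHS]big_mkcond; apply: eq_bigr => y _.
rewrite rmorphM /= (character_conj j y pP tX).
case: eqVneq => [->|y0]; first by rewrite invr0 X0 !mulr0.
rewrite mulr_suml (reindex (fun a => a * y)) /=; last first.
  by exists (fun a => a / y) => a _; rewrite ?mulfK ?divfK.
by apply: eq_bigr => a _; rewrite mulrACA -XM mulfK.
Qed.

(** Expand both transforms and apply the orthogonality of columns to X j (x / y). *)
Lemma mult_parseval (R : realType) (p : nat) (X : 'I_p.-1 -> 'F_p -> R[i]) f h :
  prime p -> is_character_table X ->
  \sum_j mult_transform X f j * (mult_transform X h j)^*
    = p.-1%:R * \sum_(x | x != 0) f x * (h x)^*.
Proof.
move=> pP tX; have [X1 XM Xsum _ _] := tX.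
transitivity (\sum_x \sum_y f x * (h y)^* * \sum_j X j (x / y)).
  rewrite /mult_transform.
  under eq_bigr do rewrite rmorph_sum mulr_suml.
  rewrite exchange_big; apply: eq_bigr => x _ /=.
  under eq_bigr do rewrite mulr_sumr.
  rewrite exchange_big; apply: eq_bigr => y _ /=.
  rewrite mulr_sumr; apply: eq_bigr => j _.
  by rewrite rmorphM /= (character_conj _ _ pP tX) mulrACA XM.
rewrite mulr_sumr [RHS]big_mkcond; apply: eq_bigr => x _.
case: eqVneq => [->|x0].
  by rewrite big1// => y _; rewrite mul0r Xsum eq_sym oner_eq0 mulr0.
rewrite (bigD1 x)//= divff// Xsum eqxx big1 ?addr0 1?mulrC// => y yx.
rewrite Xsum; case: eqP => [xy1|_]; last by rewrite mulr0.
have y0 : y != 0.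
  by apply: contraPneq xy1 => ->; rewrite invr0 mulr0 => /esym/eqP; rewrite oner_eq0.
by move: yx; rewrite -[x](divfK y0) xy1 mul1r eqxx.
Qed.

Lemma mult_parseval_normc (R : realType) (p : nat) (X : 'I_p.-1 -> 'F_p -> R[i]) f :
  prime p -> is_character_table X ->
  \sum_j normc (mult_transform X f j) ^+ 2
    = p.-1%:R * \sum_(x | x != 0) normc (f x) ^+ 2.
Proof.
move=> pP tX; apply: (@complexI R); rewrite rmorphM rmorph_nat !rmorph_sum /=.
rewrite -(eq_bigr _ (fun j _ => mulcJ (mult_transform X f j))) mult_parseval//.
by congr (_ * _); apply: eq_bigr => x _; rewrite mulcJ.
Qed.

(** Parseval for the autocorrelations: this replaces pointwise estimates for cubic
    character sums by their autocorrelation, which only involves plain cubic Gauss sums. *)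
Lemma fourth_moment (R : realType) (p : nat) (X : 'I_p.-1 -> 'F_p -> R[i]) f h :
  prime p -> is_character_table X ->
  (\sum_j normc (mult_transform X f j) ^+ 2 * normc (mult_transform X h j) ^+ 2)%:C%C
    = p.-1%:R * \sum_(a | a != 0) autocorr f a * (autocorr h a)^*.
Proof.
move=> pP tX; rewrite rmorph_sum /= -(mult_parseval _ _ pP tX); apply: eq_bigr => j _.
rewrite rmorphM /= -!mulcJ -!mult_transform_sqr// !rmorphM /= conjCK.
by congr (_ * _); rewrite mulrC.
Qed.

(** * Additive characters and cubic Gauss sums *)

Lemma eD (R : realType) (x y : R) : e (x + y) = e x * e y.
Proof.
rewrite /e mulrDr cosD sinD; apply/eqP.
by rewrite eq_complex /= [X in _ && (_ == X)]addrC !eqxx.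
Qed.

Lemma e0 (R : realType) : e 0 = 1 :> R[i].
Proof. by rewrite /e mulr0 cos0 sin0. Qed.

Lemma e1 (R : realType) : e 1 = 1 :> R[i].
Proof. by rewrite /e mulr1 mulr_natl cos2pi sin2pi. Qed.

Lemma e_int (R : realType) (z : int) : e z%:~R = 1 :> R[i].
Proof.
have en n : e n%:R = 1 :> R[i].
  by elim: n => [|n IH]; rewrite ?e0// -natr1 eD IH e1 mulr1.
case: z => n; first exact: en.
have := eD (n.+1%:R : R) (- n.+1%:R); rewrite subrr e0 en mul1r => <-//.
Qed.

Lemma e_conj (R : realType) (x : R) : (e x)^* = e (- x).
Proof. by rewrite /e mulrN cosN sinN. Qed.

Definition add_char {R : realType} (p : nat) (x : 'F_p) : R[i] :=
  e ((x : nat)%:R / p%:R).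

(** Both sides depend on z modulo p only, because e has period 1. *)
Lemma add_char_int (R : realType) (p : nat) (z : int) : prime p ->
  add_char (z%:~R : 'F_p) = e (z%:~R / p%:R) :> R[i].
Proof.
move=> pP; have p0 : (p%:R : R) != 0 by rewrite pnatr_eq0 -lt0n prime_gt0.
have pz0 : (p%:Z != 0)%R by rewrite -[0%R]/(0%:Z)  eqz_nat -lt0n prime_gt0.
have Fp0 : (p%:R : 'F_p) = 0 by rewrite -Fp_nat_mod// modnn.
have [q [n [-> np]]] : exists q : int, exists n : nat, z = q * p%:Z + n%:Z /\ (n < p)%N.
  exists (z %/ p)%Z; have := modz_ge0 z pz0; have := ltz_mod z pz0.
  case Er : (z %% p)%Z => [n|//] np _; exists n; split=> //.
  by rewrite -Er -divz_eq.
rewrite !rmorphD !rmorphM /= -![p%:Z%:~R]/(p%:R) Fp0 mulr0 add0r.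
rewrite /add_char val_Fp_nat// modn_small//.
by rewrite mulrDl mulfK// eD e_int mul1r.
Qed.

Lemma add_charD (R : realType) (p : nat) (x y : 'F_p) : prime p ->
  add_char (x + y) = add_char x * add_char y :> R[i].
Proof.
move=> pP; rewrite -eD -mulrDl -natrD.
rewrite -{1}[x]natr_Zp -{1}[y]natr_Zp -natrD.
exact: (add_char_int R (x + y)%N pP).
Qed.

Lemma add_charN (R : realType) (p : nat) (x : 'F_p) : prime p ->
  (add_char x)^* = add_char (- x) :> R[i].
Proof.
move=> pP; rewrite e_conj -{2}[x]natr_Zp -mulNr.
by have := add_char_int R (- (x : nat)%:Z) pP; rewrite !rmorphN /= => ->.
Qed.

(** For p > 2 the angle 2 pi / p lies strictly between 0 and pi, so its sine is positive. *)
Lemma add_char1_neq1 (R : realType) (p : nat) : prime p -> odd p ->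
  add_char (1 : 'F_p) != 1 :> R[i].
Proof.
move=> pP po; have p3 : (2 < p)%N by rewrite odd_prime_gt2.
have -> : add_char (1 : 'F_p) = e (p%:R^-1) :> R[i].
  by rewrite -[1]/(1%:~R) add_char_int// mul1r.
rewrite /e eq_complex /= negb_and; apply/orP; right.
have p3' : (2 : R) < p%:R by rewrite ltr_nat.
rewrite gt_eqF// sin_gt0_pi// !mulr_gt0 ?pi_gt0 ?invr_gt0//=; last lra.
rewrite ltr_pdivrMr; last lra.
by rewrite mulrC ltr_pM2l// pi_gt0.
Qed.

(** For m != 0 the sum is invariant under multiplication by e (1 / p) != 1. *)
Lemma sum_add_char (R : realType) (p : nat) (m : 'F_p) : prime p -> odd p ->
  \sum_(x : 'F_p) add_char (x * m) = if m == 0 then p%:R else 0 :> R[i].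
Proof.
move=> pP po; case: eqVneq => [->|m0].
  under eq_bigr do rewrite mulr0 /add_char mul0r e0.
  by rewrite sumr_const card_Fp.
rewrite (reindex_inj (mulIf (invr_neq0 m0))) /=.
under eq_bigr do rewrite mulfVK//.
set S := \sum_x _; have : add_char (1 : 'F_p) * S = S.
  rewrite {2}/S (reindex_inj (addrI 1)) mulr_sumr.
  by apply: eq_bigr => x _; rewrite add_charD.
move/eqP; rewrite -[X in _ == X]mul1r -subr_eq0 -mulrBl mulf_eq0 subr_eq0.
by rewrite (negPf (add_char1_neq1 R pP po)) => /eqP.
Qed.

Definition cubic_gauss {R : realType} (p : nat) (m : 'F_p) : R[i] :=
  \sum_(x : 'F_p) add_char (m * x ^+ 3).

Lemma card_cube_roots (F : finFieldType) (c : F) : (#|[pred x | x ^+ 3 == c]| <= 3)%N.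
Proof.
rewrite cardE; set s := enum _.
have := @max_poly_roots _ ('X^3 - c%:P) s.
rewrite size_XnsubC// ltnS; apply; last exact: enum_uniq.
  by rewrite -size_poly_eq0 size_XnsubC.
by apply/allP => x; rewrite mem_enum inE /root !hornerE => /eqP ->; rewrite subrr.
Qed.

(** By orthogonality this counts the pairs with x^3 = y^3, and each y has at most three
    partners x. *)
Lemma cubic_gauss_second_moment (R : realType) (p : nat) : prime p -> odd p ->
  \sum_(m : 'F_p) normc (cubic_gauss m : R[i]) ^+ 2 <= 3 * p%:R ^+ 2 :> R.
Proof.
move=> pP po.
suff -> : \sum_(m : 'F_p) normc (cubic_gauss m : R[i]) ^+ 2
    = p%:R * \sum_(y : 'F_p) #|[pred x : 'F_p | x ^+ 3 == y ^+ 3]|%:R.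
  rewrite mulrCA ler_wpM2l// -[in leRHS](card_Fp pP) mulr_natr -sumr_const.
  by apply: ler_sum => y _; rewrite ler_nat card_cube_roots.
apply: (@complexI R); rewrite rmorphM rmorph_nat !rmorph_sum /=.
transitivity (\sum_(m : 'F_p) \sum_(y : 'F_p) \sum_(x : 'F_p)
    add_char (m * (x ^+ 3 - y ^+ 3)) : R[i]).
  apply: eq_bigr => m _; rewrite -mulcJ /cubic_gauss rmorph_sum mulr_sumr.
  apply: eq_bigr => y _; rewrite mulr_suml; apply: eq_bigr => x _.
  by rewrite /= add_charN// -add_charD// mulrBr.
rewrite exchange_big mulr_sumr; apply: eq_bigr => y _ /=.
rewrite exchange_big /=; under eq_bigr do rewrite sum_add_char// subr_eq0.
by rewrite -big_mkcond sumr_const rmorph_nat mulr_natr.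
Qed.

(** The modulus is the same at m and at m c^3 for all units c. Averaging the second
    moment over these p - 1 points, each hit at most three times, gives the square root
    cancellation without any algebraic geometry. *)
Lemma cubic_gauss_le (R : realType) (p : nat) (m : 'F_p) : prime p -> odd p ->
  m != 0 -> normc (cubic_gauss m : R[i]) ^+ 2 <= 18 * p%:R.
Proof.
move=> pP po m0; pose G (x : 'F_p) : R := normc (cubic_gauss x : R[i]) ^+ 2.
have G0 x : 0 <= G x by rewrite sqr_ge0.
have GmE c : c != 0 -> G (m * c ^+ 3) = G m.
  move=> c0; rewrite /G /cubic_gauss [in RHS](reindex_inj (mulfI c0)) /=.
  by congr (normc _ ^+ 2); apply: eq_bigr => x _; rewrite exprMn -[in LHS]mulrA.
have : p.-1%:R * G m <= 3 * \sum_x G x.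
  have -> : p.-1%:R * G m = \sum_(c : 'F_p | c != 0) G (m * c ^+ 3).
    rewrite (eq_bigr (fun=> G m)) => [|c c0]; last exact: GmE.
    by rewrite sumr_const cardC1 card_Fp// mulr_natl.
  have -> : \sum_(c : 'F_p | c != 0) G (m * c ^+ 3)
      = \sum_x \sum_(c : 'F_p | (c != 0) && (m * c ^+ 3 == x)) G x.
    rewrite (partition_big (fun c => m * c ^+ 3) xpredT)//=.
    by apply: eq_bigr => x _; apply: eq_bigr => c /andP[_ /eqP ->].
  rewrite mulr_sumr; apply: ler_sum => x _; rewrite sumr_const -[leLHS]mulr_natl.
  rewrite ler_wpM2r// ler_nat; apply: leq_trans (card_cube_roots (x / m)).
  apply: subset_leq_card; apply/fintype.subsetP => c; rewrite !inE => /andP[_ /eqP <-].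
  by rewrite mulrAC mulfV// mul1r.
have p2 : (2 : R) <= p%:R by rewrite ler_nat prime_gt1.
rewrite -subn1 natrB ?prime_gt0// => leG.
have := cubic_gauss_second_moment R pP po; rewrite -/G => le2.
have leG' : p%:R * G m <= p%:R * (18 * p%:R).
  have := G0 m; move: le2 leG p2; rewrite /G; set S := \sum_m _; set g := normc _ ^+ 2.
  by rewrite expr2; nra.
by rewrite -(@ler_pM2l _ p%:R)//; lra.
Qed.

(** * Convergence of complex sequences *)

Lemma Re_le_normc (R : rcfType) (z : R[i]) : `|complex.Re z| <= normc z.
Proof.
case: z => a b /=; rewrite -[leLHS]sqrtr_sqr ler_wsqrtr//.
by rewrite lerDl sqr_ge0.
Qed.

Lemma Im_le_normc (R : rcfType) (z : R[i]) : `|complex.Im z| <= normc z.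
Proof.
case: z => a b /=; rewrite -[leLHS]sqrtr_sqr ler_wsqrtr//.
by rewrite lerDr sqr_ge0.
Qed.

Lemma normc_le_ReIm (R : rcfType) (z : R[i]) :
  normc z <= `|complex.Re z| + `|complex.Im z|.
Proof.
case: z => a b /=; rewrite -[leRHS]ger0_norm ?addr_ge0// -[leRHS]sqrtr_sqr ler_wsqrtr//.
by rewrite sqrrD !real_normK ?num_real// addrAC lerDl mulrn_wge0// mulr_ge0.
Qed.

Lemma real_cauchy_limit (R : realType) (u : nat -> R) (b : nat -> R) :
  (forall eps, 0 < eps -> exists M, b M < eps) ->
  (forall M N, (M <= N)%N -> `|u N - u M| <= b M) ->
  exists l, forall M, `|l - u M| <= b M.
Proof.
move=> b0 ub; have cu : cvgn u.
  apply: cauchy_cvg; apply: cauchy_exP => eps eps0.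
  have [M bM] := b0 _ eps0; exists (u M); exists M => // n /= Mn.
  by rewrite -ball_normE /= distrC (le_lt_trans (ub _ _ Mn)).
exists (limn u) => M.
have : (fun n => `|u n - u M|) @ \oo --> `|limn u - u M|.
  by apply: cvg_norm; apply: cvgB => //; exact: cvg_cst.
move/cvgr_to_le; apply; exists M => // n /= Mn; exact: ub.
Qed.

(** An explicit Cauchy rate gives both the convergence and the distance to the limit.
    The factor 2 comes from treating the real and imaginary parts separately. *)
Lemma complex_limn_dist (R : realType) (s : nat -> R[i]) (b : nat -> R) (M : nat) :
  (forall eps, 0 < eps -> exists M, forall N, (M <= N)%N -> b N < eps) ->
  (forall M N, (M <= N)%N -> normc (s N - s M) <= b M) ->
  normc (limn (s : nat -> R[i]^o) - s M) <= 2 * b M.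
Proof.
move=> b0 sb.
have b0' eps : 0 < eps -> exists M, b M < eps.
  by move=> /b0[N bN]; exists N; exact: bN.
have [x xP] : exists l, forall M, `|l - complex.Re (s M)| <= b M.
  apply: real_cauchy_limit b0' _ => K N KN; apply: le_trans (sb _ _ KN).
  by rewrite -raddfB; exact: Re_le_normc.
have [y yP] : exists l, forall M, `|l - complex.Im (s M)| <= b M.
  apply: real_cauchy_limit b0' _ => K N KN; apply: le_trans (sb _ _ KN).
  by rewrite -raddfB; exact: Im_le_normc.
have dist N : normc ((x +i* y)%C - s N) <= 2 * b N.
  apply: le_trans (normc_le_ReIm _) _; rewrite !raddfB /= mulr2n mulrDl mul1r.
  exact: lerD.
suff -> : limn (s : nat -> R[i]^o) = (x +i* y)%C by exact: dist.
apply: cvg_lim; first exact: norm_hausdorff.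
apply/cvgrPdist_lt => eps eps0.
have [eps' eps'0 epsE] : exists2 e' : R, 0 < e' & eps = e'%:C%C.
  case: eps eps0 => a c; rewrite ltcE /= => /andP[/eqP-> a0]; by exists a.
have [N bN] := b0 (eps' / 2) (divr_gt0 eps'0 (ltr0n _ 2)).
exists N => // n /= Nn; rewrite epsE -[ltLHS]/((normc _)%:C%C) ltcR.
apply: le_lt_trans (dist n) _.
by rewrite -ltr_pdivlMl// mulrC bN.
Qed.

(** Summation by parts, the differences 1 / k - 1 / (k + 1) telescoping to at most 1 / M. *)
Lemma abel_tail (R : realType) (chi : nat -> R[i]) (B : R) (M N : nat) :
  (0 < M <= N)%N ->
  (forall n, normc (\sum_(M <= k < n) chi k) <= B) ->
  normc (\sum_(M <= k < N) chi k / k%:R) <= B / M%:R.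
Proof.
move=> /andP[M0 MN] AB; pose A n := \sum_(M <= k < n) chi k.
have inv_diff k : (0 < k)%N -> 0 <= k%:R^-1 - k.+1%:R^-1 :> R.
  by move=> k0; rewrite subr_ge0 lef_pV2 ?posrE ?ltr0n// ler_nat.
have abel n : (M <= n)%N -> \sum_(M <= k < n) chi k / k%:R
    = A n / n%:R + \sum_(M <= k < n) A k.+1 * (k%:R^-1 - k.+1%:R^-1).
  elim: n => [|n IH]; first by rewrite leqn0 => /eqP Mz; rewrite Mz in M0.
  rewrite leq_eqVlt => /predU1P[<-|Mn]; first by rewrite /A !big_geq// mul0r addr0.
  rewrite !big_nat_recr//= IH// /A (big_nat_recr n)//=; ring.
rewrite abel//; apply: le_trans (le_normcD _ _) _.
have normcVn k : normc (k%:R^-1 : R[i]) = k%:R^-1.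
  by rewrite normcV -[k%:R](rmorph_nat (@real_complex R)) normc_real ger0_norm.
have B0 : 0 <= B by apply: le_trans (AB 0%N); rewrite normc_ge0.
apply: (@le_trans _ _ (B / N%:R + \sum_(M <= k < N) B * (k%:R^-1 - k.+1%:R^-1))).
  apply: lerD; first by rewrite normcM normcVn ler_wpM2r ?invr_ge0//; exact: AB.
  apply: le_trans (normc_sum _ _ _) _; rewrite !big_seq; apply: ler_sum => k.
  rewrite mem_index_iota => /andP[Mk _]; rewrite normcM.
  have -> : (k%:R^-1 - k.+1%:R^-1 : R[i]) = (k%:R^-1 - k.+1%:R^-1 : R)%:C%C.
    by rewrite rmorphB !fmorphV !rmorph_nat.
  have k0 := leq_trans M0 Mk.
  by rewrite normc_real ger0_norm ?inv_diff// ler_wpM2r ?inv_diff//; exact: AB.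
rewrite -mulr_sumr -mulrDr ler_wpM2l//.
under eq_bigr do rewrite -opprB.
by rewrite sumrN telescope_sumr// opprB addrC subrK.
Qed.

(** * Cubic sums and L-values over the prime field *)

(** The type 'F_p is the type of ordinals below a number that equals p only propositionally. *)
Lemma sum_Fp_nat (V : nmodType) (p : nat) (F : 'F_p -> V) : prime p ->
  \sum_x F x = \sum_(0 <= a < p) F a%:R.
Proof.
move=> pP; have Ep : (Zp_trunc (pdiv p)).+2 = p by exact: Fp_cast.
transitivity (\sum_(0 <= a < (Zp_trunc (pdiv p)).+2) F a%:R).
  by rewrite big_mkord; apply: eq_bigr => x _; rewrite natr_Zp.
have rng m : m = p -> \sum_(0 <= a < m) F a%:R = \sum_(0 <= a < p) F a%:R by move=> ->.
exact: rng Ep.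
Qed.

Lemma sum_Fp_nat1 (V : nmodType) (p : nat) (F : 'F_p -> V) : prime p ->
  F 0 = 0 -> \sum_x F x = \sum_(1 <= a < p) F a%:R.
Proof.
by move=> pP F0; rewrite sum_Fp_nat// big_ltn ?prime_gt0// F0 add0r.
Qed.

Lemma cubic_sum_transform (R : realType) (p : nat) (X : 'I_p.-1 -> 'F_p -> R[i])
    (n : int) j : prime p -> is_character_table X ->
  cubic_sum p n (fun a => X j a%:R)
    = mult_transform X (fun x => add_char (n%:~R * x ^+ 3)) j.
Proof.
move=> pP [X1 _ _ _ _].
have X0 : X j 0 = 0 by apply/eqP; rewrite (X1 j).2.
have Fp0 : (p%:R : 'F_p) = 0 by rewrite -Fp_nat_mod// modnn.
rewrite /mult_transform sum_Fp_nat1 ?X0 ?mulr0// /cubic_sum.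
(* The term a = p of the cubic sum vanishes, as does the term x = 0 of the transform. *)
rewrite big_nat_recr ?prime_gt0//= Fp0 X0 mul0r addr0; apply: eq_bigr => a _.
have castE (S : pzRingType) : (n * a%:Z ^+ 3)%:~R = n%:~R * a%:R ^+ 3 :> S.
  by rewrite intrM [X in _ * X]rmorphXn.
by rewrite -(castE 'F_p) add_char_int// castE mulrC.
Qed.

Lemma sum_nontrivial_character (R : realType) (p : nat)
    (X : 'I_p.-1 -> 'F_p -> R[i]) (j : 'I_p.-1) :
  prime p -> is_character_table X -> (j : nat) != 0%N -> \sum_x X j x = 0.
Proof.
move=> pP [X1 XM _ [_ X0] _] j0.
have [y [y0 Xy]] : exists y, y != 0 /\ X j y != 1.
  apply: contrapT => /forallNP nX; move/eqP: j0; apply; apply/X0/funext => x.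
  have [->|x0] := eqVneq x 0; first by apply/eqP; rewrite (X1 j).2.
  by have /not_andP[/(_ x0)//|/negP/negPn/eqP] := nX x.
set S := \sum_x _; have : X j y * S = S.
  rewrite {2}/S (reindex_inj (mulfI y0)) mulr_sumr.
  by apply: eq_bigr => x _; rewrite XM.
move/eqP; rewrite -[X in _ == X]mul1r -subr_eq0 -mulrBl mulf_eq0 subr_eq0.
by rewrite (negPf Xy) => /eqP.
Qed.

Lemma periodic_sum_le (R : realType) (p : nat) (chi : nat -> R[i]) (M n : nat) :
  (0 < p)%N -> (forall k, chi (k + p)%N = chi k) -> (forall k, normc (chi k) <= 1) ->
  \sum_(0 <= k < p) chi k = 0 ->
  normc (\sum_(M <= k < n) chi k) <= 2 * p%:R.
Proof.
move=> p0 chiP chi1 chi_sum; pose A m := \sum_(0 <= k < m) chi k.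
have AP m : A (m + p)%N = A m.
  elim: m => [|m IH]; first by rewrite add0n /A chi_sum big_geq.
  by rewrite addSn /A !big_nat_recr//= -/(A _) IH chiP.
have Amod m : A m = A (m %% p)%N.
  rewrite {1}(divn_eq m p); elim: (m %/ p)%N => [//|k IH].
  by rewrite mulSn -addnA addnC AP.
have Ale m : normc (A m) <= p%:R.
  rewrite Amod; apply: le_trans (normc_sum _ _ _) _.
  apply: (@le_trans _ _ (\sum_(0 <= k < m %% p) 1)); first exact: ler_sum.
  by rewrite sumr_const_nat subn0 ler_nat ltnW// ltn_pmod.
have [Mn|nM] := leqP M n; last first.
  by rewrite big_geq ?(ltnW nM)// normc0 mulr_ge0.
have -> : \sum_(M <= k < n) chi k = A n - A M.
  by rewrite /A (big_cat_nat (m := 0%N) (n := M) (p := n))//= [X in X - _]addrC addrK.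
apply: le_trans (le_normcD _ _) _; rewrite normcN mulr2n mulrDl mul1r.
exact: lerD.
Qed.

(** The partial sums of a nonprincipal character are bounded by 2p, so by partial
    summation the tail of the series beyond p^2 is O(1 / p). *)
Lemma dirichletL_approx (R : realType) (p : nat)
    (X : 'I_p.-1 -> 'F_p -> R[i]) (j : 'I_p.-1) :
  prime p -> is_character_table X -> (j : nat) != 0%N ->
  normc (dirichletL 1 (fun a => X j a%:R)
    - \sum_(1 <= k < p ^ 2) X j k%:R / k%:R) <= 4 / p%:R.
Proof.
move=> pP tX j0; have p0 := prime_gt0 pP.
pose s n := \sum_(1 <= k < n.+1) X j k%:R / k%:R.
have Fp0 : (p%:R : 'F_p) = 0 by rewrite -Fp_nat_mod// modnn.
have sE : series (fun k => X j k.+1%:R / (k.+1%:R `^ 1)%:C%C) = s.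
  apply/funext => n; rewrite /series /s /= big_add1 /=; apply: eq_bigr => k _.
  by rewrite powRr1// rmorph_nat.
rewrite /dirichletL sE.
have p20 : (0 < p ^ 2)%N by rewrite expn_gt0 p0.
have := @complex_limn_dist R s (fun n => 2 * p%:R / n.+1%:R) (p ^ 2).-1.
rewrite /s prednK//.
have -> : 2 * (2 * p%:R / (p ^ 2)%:R) = 4 / p%:R :> R.
  by rewrite natrX; field; rewrite pnatr_eq0 -lt0n.
apply.
  move=> eps eps0; exists (Num.truncn (2 * p%:R / eps)) => N le_N.
  rewrite ltr_pdivrMr// [ltRHS]mulrC -ltr_pdivrMr//.
  have : 2 * p%:R / eps < (Num.truncn (2 * p%:R / eps)).+1%:R.
    exact: truncnS_gt.
  by move/lt_le_trans; apply; rewrite ler_nat ltnS.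
move=> M N MN.
have -> : \sum_(1 <= k < N.+1) X j k%:R / k%:R - \sum_(1 <= k < M.+1) X j k%:R / k%:R
    = \sum_(M.+1 <= k < N.+1) X j k%:R / k%:R.
  by rewrite (big_cat_nat (m := 1%N) (n := M.+1) (p := N.+1))//= [X in X - _]addrC addrK.
apply: (@abel_tail _ (fun k => X j k%:R)) => [//|n].
apply: periodic_sum_le => // [k|k|]; first by rewrite natrD Fp0 addr0.
- by rewrite character_normc// lern1; case: (_ != _).
- by rewrite -sum_Fp_nat// sum_nontrivial_character.
Qed.

(** * The square of the truncated square root *)

(** Group the pairs (d, n) of integers below p by their product k = d n. *)
Lemma sqr_sum_divisors (A : comNzRingType) (h : nat -> A) (p : nat) :
  (\sum_(1 <= m < p) h m) ^+ 2 = \sum_(1 <= k < p ^ 2)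
    \sum_(d <- divisors k | (d < p)%N && (k %/ d < p)%N) h d * h (k %/ d)%N.
Proof.
transitivity (\sum_(1 <= k < p ^ 2)
    \sum_(1 <= d < p | (d %| k)%N && (k %/ d < p)%N) h d * h (k %/ d)%N); last first.
  apply: eq_big_nat => k /andP[k0 _]; rewrite -[LHS]big_filter -[RHS]big_filter.
  apply: perm_big; apply: uniq_perm; rewrite ?filter_uniq ?iota_uniq ?divisors_uniq//.
  move=> d; rewrite !mem_filter mem_index_iota -dvdn_divisors//.
  have [dk|] := boolP (d %| k)%N; last by rewrite !andbF.
  by rewrite (dvdn_gt0 k0 dk) /= andbT andbC.
under [RHS]eq_bigr do rewrite big_mkcond; rewrite exchange_big_nat /= expr2 mulr_suml.
apply: eq_big_nat => d /andP[d0 dp]; rewrite mulr_sumr -big_mkcond /=.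
transitivity (\sum_(k <- [seq (d * n)%N | n <- index_iota 1 p]) h d * h (k %/ d)%N).
  by rewrite big_map; apply: eq_bigr => n _; rewrite mulKn.
rewrite -[RHS]big_filter; apply: perm_big; apply: uniq_perm.
- rewrite map_inj_uniq ?iota_uniq// => m n /eqP.
  by rewrite eqn_pmul2l// => /eqP.
- by rewrite filter_uniq// iota_uniq.
move=> k; rewrite mem_filter mem_index_iota; apply/mapP/idP => [[n]|].
  rewrite mem_index_iota => /andP[n0 np] ->.
  by rewrite dvdn_mulr// mulKn// np muln_gt0 d0 n0 /= -mulnn ltn_mul.
move=> /andP[/andP[dk kp] /andP[k0 _]]; exists (k %/ d)%N; last by rewrite mulnC divnK.
by rewrite mem_index_iota kp andbT divn_gt0// dvdn_leq.
Qed.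

(** The part of the Dirichlet convolution of r with itself seen by factors below p. *)
Definition truncated_conv {R : realType} (p k : nat) : R :=
  \sum_(d <- divisors k | (d < p)%N && (k %/ d < p)%N) r d * r (k %/ d)%N.

Lemma truncated_conv_ge0 (R : realType) (p k : nat) : 0 <= truncated_conv p k :> R.
Proof. by rewrite /truncated_conv sumr_ge0// => d _; rewrite mulr_ge0 ?r_ge0. Qed.

Lemma truncated_conv_le1 (R : realType) (p k : nat) : (0 < k)%N ->
  truncated_conv p k <= 1 :> R.
Proof.
move=> k0; rewrite -(r_dirichlet_conv R k0) /truncated_conv [leLHS]big_mkcond.
by apply: ler_sum => d _; case: ifP => // _; rewrite mulr_ge0 ?r_ge0.
Qed.

(** Below p the truncation loses nothing, and the full convolution is 1. *)
Lemma truncated_conv_small (R : realType) (p k : nat) : (0 < k < p)%N ->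
  truncated_conv p k = 1 :> R.
Proof.
move=> /andP[k0 kp]; rewrite -(r_dirichlet_conv R k0) /truncated_conv [LHS]big_mkcond.
apply: eq_big_seq => d; rewrite -dvdn_divisors// => dk.
by rewrite (leq_ltn_trans (dvdn_leq k0 dk) kp) (leq_ltn_trans (leq_div _ _) kp).
Qed.

Definition sqrt_weight {R : realType} (m : nat) : R := r m / m%:R.

Lemma sqrt_weight_divisor (R : realType) (d k : nat) : (0 < k)%N -> (d %| k)%N ->
  sqrt_weight d * sqrt_weight (k %/ d) = r d * r (k %/ d)%N / k%:R :> R.
Proof.
by move=> k0 dk; rewrite /sqrt_weight mulrACA -invfM -natrM [(d * _)%N]mulnC divnK.
Qed.

Lemma sqr_sum_sqrt_weight (R : realType) (A : comNzRingType) (i : {rmorphism R -> A})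
    (chi : nat -> A) (p : nat) : (forall m n, chi (m * n)%N = chi m * chi n) ->
  (\sum_(1 <= m < p) i (sqrt_weight m) * chi m) ^+ 2
    = \sum_(1 <= k < p ^ 2) i (truncated_conv p k / k%:R) * chi k.
Proof.
move=> chiM; rewrite sqr_sum_divisors; apply: eq_big_nat => k /andP[k0 _].
rewrite /truncated_conv mulr_suml rmorph_sum mulr_suml big_seq_cond [RHS]big_seq_cond.
apply: eq_bigr => d /andP[]; rewrite -dvdn_divisors// => dk _.
by rewrite -sqrt_weight_divisor// rmorphM mulrACA -chiM [(d * _)%N]mulnC divnK.
Qed.

(** Squaring the sum of r(m) / m gives at most the harmonic sum up to p^2, so the sum
    itself is only of order the square root of ln p. *)
Lemma sum_sqrt_weight_sqr_le (R : realType) (p : nat) : (0 < p)%N ->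
  (\sum_(1 <= m < p) sqrt_weight m) ^+ 2 <= 1 + 2 * ln p%:R :> R.
Proof.
move=> p0.
have := @sqr_sum_sqrt_weight R R idfun (fun=> 1) p (fun _ _ => esym (mulr1 1)).
rewrite (eq_bigr sqrt_weight) => [->|m _]; last by rewrite mulr1.
apply: (@le_trans _ _ (\sum_(1 <= k < (p ^ 2).+1) k%:R^-1)).
  rewrite big_nat_recr ?expn_gt0 ?p0//= -[leLHS]addr0 lerD ?invr_ge0//.
  rewrite !big_nat; apply: ler_sum => k /andP[k0 _].
  by rewrite mulr1 ler_piMl ?invr_ge0// truncated_conv_le1.
apply: le_trans (harmonic_le_ln R _) _; first by rewrite expn_gt0 p0.
by rewrite natrX lnXn ?ltr0n// -[_ *+ 2]mulr_natl.
Qed.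

(** In a residue class, the integers from p up to p^2 are determined by their quotient by p. *)
Lemma sum_inv_class_le (R : realType) (p : nat) (x : 'F_p) : prime p ->
  \sum_(p <= k < p ^ 2 | (k%:R : 'F_p) == x) k%:R^-1 <= (1 + ln p%:R) / p%:R :> R.
Proof.
move=> pP; have p0 := prime_gt0 pP.
pose s := [seq k <- index_iota p (p ^ 2) | (k%:R : 'F_p) == x].
have sP k : k \in s -> [/\ (p <= k)%N, (k < p ^ 2)%N & (k %% p)%N = x].
  rewrite mem_filter mem_index_iota => /andP[/eqP <- /andP[pk kp]].
  by rewrite val_Fp_nat.
(* 1 / k is at most 1 / (q p), where q is the quotient of k by p. *)
apply: (@le_trans _ _ (\sum_(q <- [seq (k %/ p)%N | k <- s]) q%:R^-1 / p%:R)).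
  rewrite -big_filter -/s big_map big_seq [leRHS]big_seq; apply: ler_sum => k /sP[pk _ _].
  rewrite -invfM -natrM lef_pV2 ?posrE ?ltr0n ?muln_gt0 ?divn_gt0 ?p0 ?pk//.
    by rewrite ler_nat mulnC mulnC leq_trunc_div.
  exact: leq_trans p0 pk.
rewrite -mulr_suml ler_wpM2r ?invr_ge0//.
apply: le_trans (harmonic_le_ln R p0).
apply: ler_sum_sub_uniq; rewrite ?iota_uniq//.
- rewrite map_inj_in_uniq ?filter_uniq ?iota_uniq// => k l /sP[_ _ kx] /sP[_ _ lx] kl.
  by rewrite (divn_eq k p) (divn_eq l p) kl kx lx.
- move=> q /mapP[k /sP[pk kp _] ->]; rewrite mem_index_iota divn_gt0// pk /=.
  by rewrite ltnS ltnW// ltn_divLR// mulnn.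
Qed.

(** * The two autocorrelations *)

Definition cubic_phase {R : realType} (p : nat) (n : int) (x : 'F_p) : R[i] :=
  add_char (n%:~R * x ^+ 3).

Lemma sum_unit_cubic (R : realType) (p : nat) (m : 'F_p) :
  \sum_(x | x != 0) add_char (m * x ^+ 3) = cubic_gauss m - 1 :> R[i].
Proof.
rewrite /cubic_gauss [in RHS](bigD1 0)//= expr0n mulr0 [add_char 0](_ : _ = 1).
  by rewrite [X in X - _]addrC addrK.
by rewrite /add_char mul0r e0.
Qed.

Lemma sum_unit_cubic_le (R : realType) (p : nat) (m : 'F_p) : prime p -> odd p ->
  m != 0 ->
  normc (\sum_(x | x != 0) add_char (m * x ^+ 3) : R[i]) <= 6 * Num.sqrt p%:R.
Proof.
move=> pP po m0; rewrite sum_unit_cubic; apply: le_trans (le_normcD _ _) _.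
rewrite normcN normc1; have := cubic_gauss_le R pP po m0.
have s0 := sqrtr_ge0 (p%:R : R); have g0 := normc_ge0 (cubic_gauss m : R[i]).
have ss := sqr_sqrtr (ler0n R p).
have s1 : 1 <= Num.sqrt p%:R :> R by rewrite -[leLHS]sqrtr1 ler_wsqrtr// ler1n prime_gt0.
move: ss s0 s1 g0; set s := Num.sqrt _; set g := normc _ => ss s0 s1 g0 g18.
suff : g <= 5 * s by lra.
by rewrite -(@ler_pXn2r _ 2)// ?nnegrE ?mulr_ge0// exprMn ss; nra.
Qed.

(** The phase at a x over the phase at x is n (a^3 - 1) x^3: a cubic Gauss sum again. *)
Lemma cubic_autocorr (R : realType) (p : nat) (n : int) (a : 'F_p) : prime p ->
  autocorr (cubic_phase n) a
    = \sum_(x | x != 0) add_char (n%:~R * (a ^+ 3 - 1) * x ^+ 3) :> R[i].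
Proof.
move=> pP; apply: eq_bigr => y _; rewrite /cubic_phase add_charN// -add_charD//.
by rewrite exprMn; congr add_char; ring.
Qed.

Lemma cubic_autocorr_root (R : realType) (p : nat) (n : int) (a : 'F_p) :
  prime p -> a ^+ 3 = 1 -> autocorr (cubic_phase n) a = p.-1%:R :> R[i].
Proof.
move=> pP a3; rewrite cubic_autocorr// a3 subrr mulr0.
rewrite (eq_bigr (fun=> 1)) => [|x _]; last by rewrite mul0r /add_char mul0r e0.
by rewrite sumr_const cardC1 card_Fp.
Qed.

Lemma coprimez_Fp_neq0 (p : nat) (n : int) : prime p -> coprimez n p ->
  (n%:~R : 'F_p) != 0.
Proof.
move=> pP; rewrite coprimezE => np; apply/negP => /eqP n0.
have : (`|n|%N%:R : 'F_p) = 0.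
  by case: n n0 {np} => m //=; rewrite NegzE rmorphN => /eqP; rewrite oppr_eq0 => /eqP.
move/eqP; rewrite -val_eqE /= val_Fp_nat// => /eqP pn.
by move: np; rewrite coprime_sym prime_coprime// /dvdn pn eqxx.
Qed.

Lemma cubic_autocorr_le (R : realType) (p : nat) (n : int) (a : 'F_p) :
  prime p -> odd p -> coprimez n p -> a ^+ 3 != 1 ->
  normc (autocorr (cubic_phase n) a : R[i]) <= 6 * Num.sqrt p%:R.
Proof.
move=> pP po np a3; rewrite cubic_autocorr// sum_unit_cubic_le//.
by rewrite mulf_neq0 ?coprimez_Fp_neq0// subr_eq0.
Qed.

Lemma sum_cube_roots_le (R : realType) (p : nat) (P : pred 'F_p) (c : R) : 0 <= c ->
  \sum_(a | P a && (a ^+ 3 == 1)) c <= 3 * c.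
Proof.
move=> c0; rewrite sumr_const -[leLHS]mulr_natl ler_wpM2r// ler_nat.
apply: leq_trans (card_cube_roots (1 : 'F_p)); apply: subset_leq_card.
by apply/fintype.subsetP => a; rewrite !inE => /andP[].
Qed.

(** The at most three cube roots of unity contribute (p - 1)^2 each, and the fewer than p
    other values of a contribute 36 p each by square root cancellation. *)
Lemma cubic_sum_fourth_moment (R : realType) (p : nat)
    (X : 'I_p.-1 -> 'F_p -> R[i]) (n : int) :
  prime p -> odd p -> coprimez n p -> is_character_table X ->
  \sum_j (normc (mult_transform X (cubic_phase n) j) ^+ 2) ^+ 2 <= 39 * p%:R ^+ 3.
Proof.
move=> pP po np tX.
have -> : \sum_j (normc (mult_transform X (cubic_phase n) j) ^+ 2) ^+ 2
    = p.-1%:R * \sum_(a : 'F_p | a != 0) normc (autocorr (cubic_phase n) a : R[i]) ^+ 2.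
  apply: (@complexI R); rewrite -[in LHS](eq_bigr _ (fun j _ => esym (expr2 _))).
  rewrite fourth_moment// rmorphM rmorph_nat rmorph_sum /=; congr (_ * _).
  by apply: eq_bigr => a _; rewrite mulcJ.
have s0 := sqrtr_ge0 (p%:R : R).
have ss := sqr_sqrtr (ler0n R p).
have Pp : (p.-1%:R : R) <= p%:R by rewrite ler_nat leq_pred.
have -> : 39 * p%:R ^+ 3 = p%:R * (39 * p%:R ^+ 2) :> R by ring.
apply: ler_pM => //; first by apply: sumr_ge0 => a _; exact: sqr_ge0.
apply: (@le_trans _ _ (\sum_(a : 'F_p | (a != 0) && (a ^+ 3 == 1)) p%:R ^+ 2
    + \sum_(a : 'F_p) 36 * p%:R)).
  rewrite big_mkcondr /= [X in _ <= _ + X](bigID (fun a => a != 0)) /= addrA -big_split /=.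
  rewrite ler_wpDr ?sumr_ge0//.
  apply: ler_sum => a _; case: eqP => [a3|/eqP a3].
    rewrite cubic_autocorr_root// -(rmorph_nat (@real_complex R)) normc_real.
    by rewrite normr_nat ler_wpDr ?mulr_ge0// ler_pXn2r ?nnegrE.
  rewrite add0r -ss -[36](_ : 6 ^+ 2 = _); last by rewrite -natrX.
  rewrite -exprMn ler_pXn2r ?nnegrE ?normc_ge0 ?mulr_ge0//.
  exact: cubic_autocorr_le.
apply: le_trans (lerD (sum_cube_roots_le _ (sqr_ge0 _)) (lexx _)) _.
by rewrite sumr_const card_Fp// -[X in _ + X]mulr_natl; lra.
Qed.

Definition weight_autocorr {R : realType} (p : nat) (a : 'F_p) : R :=
  \sum_(y : 'F_p | y != 0) sqrt_weight ((a * y)%R : 'F_p) * sqrt_weight y.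

Lemma sqrt_weight_ge0 (R : realType) (m : nat) : 0 <= sqrt_weight m :> R.
Proof. by rewrite /sqrt_weight divr_ge0// r_ge0. Qed.

Lemma weight_autocorr_ge0 (R : realType) (p : nat) (a : 'F_p) :
  0 <= weight_autocorr a :> R.
Proof. by apply: sumr_ge0 => y _; rewrite mulr_ge0 ?sqrt_weight_ge0. Qed.

Lemma autocorr_sqrt_weight (R : realType) (p : nat) (a : 'F_p) :
  autocorr (fun x : 'F_p => (sqrt_weight x)%:C%C) a = (weight_autocorr a)%:C%C :> R[i].
Proof.
rewrite /autocorr /weight_autocorr rmorph_sum; apply: eq_bigr => y _.
by rewrite [RHS]rmorphM; congr (_ * _); exact: conjc_real.
Qed.

Lemma sum_Fp_val (R : realType) (p : nat) (F : nat -> R) : prime p -> F 0%N = 0 ->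
  \sum_(x : 'F_p) F x = \sum_(1 <= m < p) F m.
Proof.
move=> pP F0; rewrite sum_Fp_nat1//; apply: eq_big_nat => m /andP[_ mp].
by rewrite val_Fp_nat// modn_small.
Qed.

Lemma sqrt_weight0 (R : realType) : sqrt_weight 0 = 0 :> R.
Proof. by rewrite /sqrt_weight invr0 mulr0. Qed.

Lemma weight_autocorr1 (R : realType) (p : nat) : prime p ->
  weight_autocorr (1 : 'F_p) = \sum_(1 <= m < p) sqr_coef m :> R.
Proof.
move=> pP; rewrite -(sum_Fp_val (F := sqr_coef))//; last first.
  by rewrite /sqr_coef expr0n invr0 mulr0.
rewrite /weight_autocorr big_mkcond; apply: eq_bigr => y _; case: eqVneq => [->|_].
  by rewrite /= /sqr_coef expr0n invr0 mulr0.
by rewrite mul1r /sqr_coef -expr_div_n expr2.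
Qed.

(** Summed over all a, the autocorrelation factors as the square of the sum of weights. *)
Lemma sum_weight_autocorr_le (R : realType) (p : nat) : prime p ->
  \sum_(a : 'F_p) weight_autocorr a <= 1 + 2 * ln p%:R :> R.
Proof.
move=> pP; apply: le_trans (sum_sqrt_weight_sqr_le R (prime_gt0 pP)).
rewrite -sum_Fp_val ?sqrt_weight0// /weight_autocorr exchange_big /=.
rewrite expr2 mulr_sumr big_mkcond; apply: ler_sum => y _; case: eqVneq => [_|y0].
  by rewrite mulr_ge0 ?sumr_ge0// => *; rewrite sqrt_weight_ge0.
by rewrite -mulr_suml [in leRHS](reindex_inj (mulIf y0)).
Qed.

Lemma cube_root_quadratic (p : nat) (a : 'F_p) : a ^+ 3 = 1 -> a != 1 ->
  a ^+ 2 + a + 1 = 0.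
Proof.
move=> a3 a1; apply: (@mulfI _ (a - 1)); first by rewrite subr_eq0.
rewrite mulr0; transitivity (a ^+ 3 - 1); first by ring.
by rewrite a3 subrr.
Qed.

(** With x = a y one has x^2 + x y + y^2 = 0 modulo p. The representatives of x and y make
    this form positive, hence at least p, and it is at most (x + y)^2. *)
Lemma sqrt_le_cube_root_pair (R : realType) (p : nat) (a y : 'F_p) : prime p ->
  a ^+ 3 = 1 -> a != 1 -> y != 0 ->
  Num.sqrt p%:R <= ((a * y)%R : 'F_p)%:R + (y : nat)%:R :> R.
Proof.
move=> pP a3 a1 y0; set x := a * y.
have q0 : ((x ^ 2 + x * y + y ^ 2)%N%:R : 'F_p) = 0.
  rewrite !natrD natrM !natrX !natr_Zp /x.
  by rewrite -[RHS](mul0r (y ^+ 2)) -(cube_root_quadratic a3 a1); ring.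
have ylt : (0 < y)%N by rewrite lt0n; apply: contra y0 => /eqP yE; apply/eqP/val_inj.
have : (p <= x ^ 2 + x * y + y ^ 2)%N.
  apply: dvdn_leq; first by rewrite addn_gt0 expn_gt0 ylt orbT.
  by move/eqP: q0; rewrite -val_eqE /= val_Fp_nat.
rewrite -(ler_nat R) !natrD natrM !natrX => le_p.
rewrite -[leRHS]ger0_norm ?addr_ge0// -[leRHS]sqrtr_sqr ler_wsqrtr//.
apply: le_trans le_p _.
have := ler0n R x; have := ler0n R y; nra.
Qed.

(** Here 1 / (x y) = (1 / x + 1 / y) / (x + y), with x = a y and x + y at least the
    square root of p by [sqrt_le_cube_root_pair]; the two remaining sums are harmonic. *)
Lemma weight_autocorr_root_le (R : realType) (p : nat) (a : 'F_p) : prime p ->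
  a ^+ 3 = 1 -> a != 1 ->
  weight_autocorr a <= 2 * (1 + ln p%:R) / Num.sqrt p%:R :> R.
Proof.
move=> pP a3 a1; set s := Num.sqrt _.
have s0 : 0 < s by rewrite sqrtr_gt0 ltr0n prime_gt0.
have a0 : a != 0 by apply: contra_eq_neq a3 => ->; rewrite expr0n eq_sym oner_eq0.
have posF (x : 'F_p) : x != 0 -> 0 < (x : nat)%:R :> R.
  by move=> x0; rewrite ltr0n lt0n; apply: contra x0 => /eqP xE; apply/eqP/val_inj.
pose inv (x : 'F_p) : R := (x : nat)%:R^-1.
have sum_inv : \sum_(y : 'F_p) inv y <= 1 + ln p%:R.
  rewrite /inv (sum_Fp_val (F := fun m => m%:R^-1))// ?invr0//.
  apply: le_trans (harmonic_le_ln R (prime_gt0 pP)).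
  by rewrite big_nat_recr ?prime_gt0//= lerDl invr_ge0.
apply: (@le_trans _ _ (\sum_(y : 'F_p) (inv (a * y) + inv y) / s)).
  rewrite /weight_autocorr big_mkcond; apply: ler_sum => y _; case: eqVneq => [_|y0].
    by rewrite divr_ge0 ?addr_ge0 ?invr_ge0// ltW.
  have ay0 : a * y != 0 by rewrite mulf_neq0.
  have := posF _ ay0; have := posF _ y0; have := sqrt_le_cube_root_pair R pP a3 a1 y0.
  rewrite /inv -/s /sqrt_weight.
  set u := (nat_of_ord y)%:R; set v := (nat_of_ord (a * y)%R)%:R => s_le u0 v0.
  apply: (@le_trans _ _ (v^-1 * u^-1)).
    rewrite ler_pM ?divr_ge0 ?r_ge0 ?(ltW u0) ?(ltW v0)//.
      by rewrite ler_piMl ?invr_ge0 ?(ltW v0)// r_le1.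
    by rewrite ler_piMl ?invr_ge0 ?(ltW u0)// r_le1.
  rewrite ler_pdivlMr// (_ : v^-1 + u^-1 = v^-1 * u^-1 * (v + u)); last first.
    by field; rewrite !gt_eqF.
  by rewrite ler_wpM2l// mulr_ge0 ?invr_ge0 ?(ltW u0) ?(ltW v0).
rewrite -mulr_suml ler_wpM2r ?invr_ge0 ?(ltW s0)// big_split /=.
rewrite -(reindex_inj (mulfI a0) (F := inv) (P := xpredT)) /= -mulr2n -[leLHS]mulr_natl.
by rewrite ler_wpM2l.
Qed.

(** The representative of a nontrivial cube root of unity is at least half the square root
    of p (take y = 1 in [sqrt_le_cube_root_pair]), so the terms C_a of the theorem are as
    small as its error term. *)
Lemma Csub_cube_root_le (R : realType) (p : nat) (a : 'F_p) : prime p ->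
  a ^+ 3 = 1 -> a != 1 -> Csub (a : nat) <= 4 / Num.sqrt p%:R :> R.
Proof.
move=> pP a3 a1.
have a0 : a != 0 by apply: contra_eq_neq a3 => ->; rewrite expr0n eq_sym oner_eq0.
have alt : (0 < a)%N by rewrite lt0n; apply: contra a0 => /eqP aE; apply/eqP/val_inj.
apply: le_trans (Csub_le R alt) _.
have s0 : 0 < Num.sqrt p%:R :> R by rewrite sqrtr_gt0 ltr0n prime_gt0.
have := sqrt_le_cube_root_pair R pP a3 a1 (oner_neq0 _); rewrite mulr1 /= modn_small// => le_s.
have a1' : (1 : R) <= (a : nat)%:R by rewrite ler1n.
rewrite ler_pdivrMr; last lra.
by rewrite mulrAC ler_pdivlMr//; lra.
Qed.

(** * Moments over the characters *)

(** Lets every bounded quantity be absorbed into a multiple of ln p. *)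
Lemma one_le_double_ln (R : realType) (p : nat) : (1 < p)%N -> 1 <= 2 * ln p%:R :> R.
Proof.
move=> p1; have : ln 2 <= ln p%:R :> R by rewrite ler_ln ?posrE ?ltr0n ?ler_nat// ltnW.
have := inv_succ_le_ln_diff R (isT : (0 < 1)%N); rewrite ln1 subr0.
by move: (ln 2) (ln p%:R) => u v; lra.
Qed.

(** The truncation below p of the Dirichlet series of the square root of L(1, chi). *)
Definition sqrtL {R : realType} (p : nat) (X : 'I_p.-1 -> 'F_p -> R[i]) :=
  mult_transform X (fun x => (sqrt_weight x)%:C%C).

(** The coefficients, by residue class, of the difference between the series of L(1, chi) cut
    at p^2 and the square of its truncated square root. *)
Definition conv_defect {R : realType} (p : nat) (x : 'F_p) : R :=
  \sum_(p <= k < p ^ 2 | (k%:R : 'F_p) == x) (1 - truncated_conv p k) / k%:R.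

Lemma conv_defect_le (R : realType) (p : nat) (x : 'F_p) : prime p ->
  `|conv_defect x| <= (1 + ln p%:R) / p%:R :> R.
Proof.
move=> pP; have defect_ge0 k : (p <= k)%N -> 0 <= 1 - truncated_conv p k :> R.
  by move=> pk; rewrite subr_ge0 truncated_conv_le1// (leq_trans (prime_gt0 pP)).
rewrite ger0_norm; last first.
  rewrite /conv_defect big_nat_cond sumr_ge0// => k /andP[/andP[pk _] _].
  by rewrite divr_ge0 ?defect_ge0.
apply: le_trans (sum_inv_class_le R x pP).
rewrite /conv_defect big_nat_cond [leRHS]big_nat_cond; apply: ler_sum => k /andP[/andP[pk _] _].
by rewrite ler_piMl ?invr_ge0// gerBl truncated_conv_ge0.
Qed.

Lemma sqrtL_sqr (R : realType) (p : nat) (X : 'I_p.-1 -> 'F_p -> R[i]) j :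
  prime p -> is_character_table X ->
  sqrtL X j ^+ 2
    = \sum_(1 <= k < p ^ 2) (truncated_conv p k / k%:R)%:C%C * X j k%:R.
Proof.
move=> pP [X1 XM _ _ _]; rewrite -sqr_sum_sqrt_weight => [|m n]; last by rewrite natrM XM.
rewrite /sqrtL /mult_transform sum_Fp_nat1//; last first.
  by rewrite /= sqrt_weight0 mul0r.
congr (_ ^+ 2); apply: eq_big_nat => m /andP[_ mp].
by rewrite val_Fp_nat// modn_small.
Qed.

(** The coefficients of the two sums agree below p by [truncated_conv_small], so only the
    integers from p up to p^2 are left. *)
Lemma partial_sum_sub_sqr (R : realType) (p : nat) (X : 'I_p.-1 -> 'F_p -> R[i]) j :
  prime p -> is_character_table X ->
  \sum_(1 <= k < p ^ 2) X j k%:R / k%:R - sqrtL X j ^+ 2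
    = mult_transform X (fun x => (conv_defect x)%:C%C) j.
Proof.
move=> pP tX; rewrite sqrtL_sqr// -sumrB.
transitivity (\sum_(1 <= k < p ^ 2) ((1 - truncated_conv p k) / k%:R)%:C%C * X j k%:R).
  apply: eq_bigr => k _; rewrite mulrBl rmorphB mul1r /= mulrBl; congr (_ - _).
  by rewrite mulrC fmorphV rmorph_nat.
have p0 := prime_gt0 pP.
rewrite (big_cat_nat (n := p))//=; last by rewrite -mulnn leq_pmulr.
rewrite big_nat big1 ?add0r => [|k kp]; last first.
  by rewrite truncated_conv_small// subrr mul0r mul0r.
rewrite /mult_transform /conv_defect.
transitivity (\sum_(p <= k < p ^ 2) \sum_(x : 'F_p | (k%:R : 'F_p) == x)
    ((1 - truncated_conv p k) / k%:R)%:C%C * X j x).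
  apply: eq_bigr => k _; rewrite (big_pred1 (k%:R : 'F_p))//.
rewrite (exchange_big_dep xpredT)//=; apply: eq_bigr => x _.
by rewrite rmorph_sum mulr_suml.
Qed.

Lemma dirichletL_sub_sqr_le (R : realType) (p : nat)
    (X : 'I_p.-1 -> 'F_p -> R[i]) (j : 'I_p.-1) :
  prime p -> is_character_table X -> (j : nat) != 0%N ->
  `|normc (dirichletL 1 (fun a => X j a%:R)) - normc (sqrtL X j) ^+ 2|
    <= 4 / p%:R + normc (mult_transform X (fun x => (conv_defect x)%:C%C) j).
Proof.
move=> pP tX j0; rewrite -normcX.
have ntri (z w : R[i]) : `|normc z - normc w| <= normc (z - w).
  rewrite ler_norml; apply/andP; split.
    have := le_normcD (w - z) z; rewrite subrK -opprB normcN => h.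
    by rewrite lerNl opprB lerBlDr.
  by have := le_normcD (z - w) w; rewrite subrK lerBlDr.
apply: le_trans (ntri _ _) _; rewrite -partial_sum_sub_sqr//.
have := dirichletL_approx pP tX j0; set L := dirichletL _ _; set Q := \sum_(_ <= k < _) _.
move=> LQ; have -> : L - sqrtL X j ^+ 2 = (L - Q) + (Q - sqrtL X j ^+ 2) by rewrite addrA subrK.
by apply: le_trans (le_normcD _ _) _; rewrite lerD2r.
Qed.

(** Parseval: each of the p - 1 classes has a coefficient of size at most (1 + ln p) / p, so
    even the sum of the squares over all characters is only of order (ln p)^2. *)
Lemma sum_defect_sqr_le (R : realType) (p : nat) (X : 'I_p.-1 -> 'F_p -> R[i]) :
  prime p -> is_character_table X ->
  \sum_j normc (mult_transform X (fun x => (conv_defect x)%:C%C) j) ^+ 2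
    <= (1 + ln p%:R) ^+ 2 :> R.
Proof.
move=> pP tX; rewrite mult_parseval_normc//.
have p0 : (0 : R) < p%:R by rewrite ltr0n prime_gt0.
have l0 : 0 <= 1 + ln p%:R :> R.
  by have := one_le_double_ln R (prime_gt1 pP); lra.
have Pp : (p.-1%:R : R) <= p%:R by rewrite ler_nat leq_pred.
have -> : (1 + ln p%:R) ^+ 2 = p%:R * (p%:R * ((1 + ln p%:R) / p%:R) ^+ 2) :> R.
  by field; rewrite gt_eqF.
apply: ler_pM => //; first by apply: sumr_ge0 => x _; exact: sqr_ge0.
apply: (@le_trans _ _ (\sum_(x : 'F_p) ((1 + ln p%:R) / p%:R) ^+ 2)).
  rewrite big_mkcond; apply: ler_sum => x _; case: ifP => _; last exact: sqr_ge0.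
  rewrite normc_real ler_pXn2r ?nnegrE// ?divr_ge0// ?(ltW p0)//.
  exact: conv_defect_le.
by rewrite sumr_const card_Fp// -[leLHS]mulr_natl.
Qed.

(** By [fourth_moment] this is p - 1 times the sum over a of the product of the two
    autocorrelations. The term a = 1 is the main term. A nontrivial cube root of unity has a
    large cubic autocorrelation and a small weight autocorrelation; for all other a the cubic
    factor is at most 6 times the square root of p, and the weights sum to O(ln p). *)
Lemma diagonal_moment (R : realType) (p : nat) (X : 'I_p.-1 -> 'F_p -> R[i]) (n : int) :
  prime p -> odd p -> coprimez n p -> is_character_table X ->
  `|\sum_j normc (mult_transform X (cubic_phase n) j) ^+ 2 * normc (sqrtL X j) ^+ 2
    - p.-1%:R ^+ 2 * \sum_(1 <= m < p) sqr_coef m|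
  <= 42 * (p%:R * Num.sqrt p%:R * ln p%:R) :> R.
Proof.
move=> pP po np tX; set S := \sum_j _; set T1 := \sum_(_ <= m < _) _.
pose K a : R[i] := @autocorr R p (cubic_phase n) a.
pose T (a : 'F_p) : R := weight_autocorr a.
set s : R := Num.sqrt _; set l : R := ln _.
have s0 : 0 < s by rewrite sqrtr_gt0 ltr0n prime_gt0.
have ss : s ^+ 2 = p%:R by rewrite sqr_sqrtr.
have l1 : 1 <= 2 * l by exact: one_le_double_ln (prime_gt1 pP).
have p0 : (0 : R) < p%:R by rewrite ltr0n prime_gt0.
have Pp : (p.-1%:R : R) <= p%:R by rewrite ler_nat leq_pred.
have SE : (S - p.-1%:R ^+ 2 * T1)%:C%C
    = p.-1%:R * \sum_(a : 'F_p | (a != 0) && (a != 1)) K a * (T a)%:C%C.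
  rewrite rmorphB rmorphM rmorphXn rmorph_nat /=.
  have -> : S%:C%C = p.-1%:R * \sum_(a : 'F_p | a != 0) K a * (T a)%:C%C.
    rewrite fourth_moment//; congr (_ * _); apply: eq_bigr => a _.
    by rewrite autocorr_sqrt_weight; congr (_ * _); exact: conjc_real.
  rewrite (bigD1 1) ?oner_neq0//= /K cubic_autocorr_root ?expr1n//.
  by rewrite /T weight_autocorr1// -/T1; ring.
have -> : `|S - p.-1%:R ^+ 2 * T1| = normc (S - p.-1%:R ^+ 2 * T1)%:C%C.
  by rewrite normc_real.
rewrite SE normcM -(rmorph_nat (@real_complex R)) normc_real normr_nat.
set W := \sum_(_ | _) _.
suff Wle : normc W <= 42 * (s * l).
  have -> : 42 * (p%:R * s * l) = p%:R * (42 * (s * l)) by ring.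
  by apply: ler_pM; rewrite ?normc_ge0.
apply: (@le_trans _ _ (\sum_(a : 'F_p | ((a != 0) && (a != 1)) && (a ^+ 3 == 1))
    p%:R * (2 * (1 + l) / s) + \sum_(a : 'F_p) 6 * s * T a)).
  apply: le_trans (normc_sum _ _ _) _.
  rewrite [X in _ <= X + _]big_mkcondr /=.
  rewrite [X in _ <= _ + X](bigID (fun a : 'F_p => (a != 0) && (a != 1))) /=.
  rewrite addrA -big_split /=.
  have T0 a : 0 <= T a by exact: weight_autocorr_ge0.
  rewrite ler_wpDr//; first by apply: sumr_ge0 => a _; rewrite !mulr_ge0// ltW.
  apply: ler_sum => a /andP[a0 a1].
  have sT0 : 0 <= 6 * s * T a by rewrite !mulr_ge0// ltW.
  rewrite normcM normc_real ger0_norm//; case: eqP => [a3|/eqP a3].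
    rewrite /K cubic_autocorr_root// -(rmorph_nat (@real_complex R)) normc_real normr_nat.
    by rewrite ler_wpDr// ler_pM// /T weight_autocorr_root_le.
  by rewrite add0r ler_wpM2r// /K cubic_autocorr_le.
have c0 : 0 <= p%:R * (2 * (1 + l) / s).
  by rewrite mulr_ge0 ?divr_ge0 ?(ltW s0) ?(ltW p0)//; lra.
apply: le_trans (lerD (sum_cube_roots_le _ c0) (lexx _)) _.
rewrite -mulr_sumr; have : \sum_a T a <= 1 + 2 * l by exact: sum_weight_autocorr_le.
set Z := \sum_a _ => Zle.
have -> : 3 * (p%:R * (2 * (1 + l) / s)) = 6 * s * (1 + l).
  by rewrite -ss; field; rewrite gt_eqF.
have : s * Z <= s * (1 + 2 * l) by rewrite ler_wpM2l// ltW.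
have : s * 1 <= s * (2 * l) by rewrite ler_wpM2l// ltW.
lra.
Qed.

Lemma constC_ge0_le2 (R : realType) : 0 <= (constC : R) <= 2.
Proof.
have [] := constC_bounds R (isT : (0 < 1)%N).
by rewrite big_geq// divr1 add0r => -> ->.
Qed.

(** The arithmetic-geometric mean inequality with a weight q plays the role of
    Cauchy-Schwarz between the fourth moment of the cubic sums, of order p^3, and the sum of
    the squares of the defect, of order (ln p)^2. *)
Lemma approximation_moment (R : realType) (p : nat)
    (X : 'I_p.-1 -> 'F_p -> R[i]) (n : int) :
  prime p -> odd p -> coprimez n p -> is_character_table X ->
  \sum_(j < p.-1 | (j : nat) != 0%N) normc (mult_transform X (cubic_phase n) j) ^+ 2
     * `|normc (dirichletL 1 (fun a => X j a%:R)) - normc (sqrtL X j) ^+ 2|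
  <= 93 * (p%:R * Num.sqrt p%:R * ln p%:R) :> R.
Proof.
move=> pP po np tX; set s : R := Num.sqrt _; set l : R := ln _.
have s0 : 0 < s by rewrite sqrtr_gt0 ltr0n prime_gt0.
have ss : s ^+ 2 = p%:R by rewrite sqr_sqrtr.
have l1 : 1 <= 2 * l by exact: one_le_double_ln (prime_gt1 pP).
have l0 : 0 < l by lra.
have p0 : (0 : R) < p%:R by rewrite ltr0n prime_gt0.
pose A j := normc (mult_transform X (cubic_phase n) j) ^+ 2.
pose U j := normc (mult_transform X (fun x => (conv_defect x)%:C%C) j).
(* This weight makes q p^3 and (ln p)^2 / q both equal to the error term. *)
pose q : R := l / (p%:R * s).
have q0 : 0 < q by rewrite divr_gt0// mulr_gt0.
have A0 j : 0 <= A j by exact: sqr_ge0.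
apply: (@le_trans _ _ (\sum_j (q / 2 * A j ^+ 2 + q^-1 * (16 / p%:R ^+ 2 + U j ^+ 2)))).
  rewrite big_mkcond; apply: ler_sum => j _.
  have B0 : 0 <= q / 2 * A j ^+ 2 + q^-1 * (16 / p%:R ^+ 2 + U j ^+ 2).
    apply: addr_ge0; apply: mulr_ge0.
    - by rewrite divr_ge0// ltW.
    - exact: sqr_ge0.
    - by rewrite invr_ge0 ltW.
    - by apply: addr_ge0; [rewrite divr_ge0// sqr_ge0|exact: sqr_ge0].
  case: ifP => // j0.
  apply: le_trans (ler_wpM2l (A0 j) (dirichletL_sub_sqr_le pP tX j0)) _.
  rewrite -/(U j); set v := 4 / p%:R; have -> : 16 / p%:R ^+ 2 = v ^+ 2.
    by rewrite /v; field; rewrite gt_eqF.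
  have := sqr_ge0 (q * A j - (v + U j)); have := sqr_ge0 (v - U j) => uv qa.
  rewrite -(ler_pM2l q0).
  have -> : q * (q / 2 * A j ^+ 2 + q^-1 * (v ^+ 2 + U j ^+ 2))
      = (q * A j) ^+ 2 / 2 + (v ^+ 2 + U j ^+ 2) by field; rewrite gt_eqF.
  by move: uv qa; move: (A j) (U j) => a u; nra.
rewrite big_split /= -!mulr_sumr big_split /=.
have E1 : \sum_j A j ^+ 2 <= 39 * p%:R ^+ 3 by exact: cubic_sum_fourth_moment.
have E2 : \sum_j U j ^+ 2 <= (1 + l) ^+ 2 by exact: sum_defect_sqr_le.
have E3 : \sum_(j < p.-1) 16 / p%:R ^+ 2 <= 16 :> R.
  rewrite sumr_const card_ord -[leLHS]mulr_natl mulrCA -[leRHS]mulr1 ler_wpM2l//.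
  rewrite ler_pdivrMr ?exprn_gt0// mul1r -natrX ler_nat.
  by rewrite (leq_trans (leq_pred _))// -mulnn leq_pmulr// prime_gt0.
have qE : q * p%:R ^+ 3 = p%:R * s * l.
  by rewrite /q -ss; field; rewrite gt_eqF.
have qVE : q^-1 * l ^+ 2 = p%:R * s * l.
  by rewrite /q; field; rewrite !gt_eqF.
have qV0 : 0 < q^-1 by rewrite invr_gt0.
have F1 : q / 2 * \sum_j A j ^+ 2 <= 20 * (p%:R * s * l).
  apply: le_trans (ler_wpM2l _ E1) _; first by rewrite divr_ge0 ?(ltW q0).
  have : 0 <= q * p%:R ^+ 3 by rewrite mulr_ge0 ?exprn_ge0 ?(ltW q0).
  rewrite -qE; move: (p%:R ^+ 3) => c; lra.
have F2 : q^-1 * (\sum_(j < p.-1) 16 / p%:R ^+ 2 + \sum_j U j ^+ 2)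
    <= 73 * (p%:R * s * l).
  rewrite -qVE [leRHS]mulrCA ler_wpM2l ?(ltW qV0)//.
  apply: le_trans (lerD E3 E2) _; nra.
lra.
Qed.

Lemma principal_moment_le (R : realType) (p : nat)
    (X : 'I_p.-1 -> 'F_p -> R[i]) (n : int) (j : 'I_p.-1) :
  prime p -> odd p -> coprimez n p -> is_character_table X -> (j : nat) = 0%N ->
  normc (mult_transform X (cubic_phase n) j) ^+ 2 * normc (sqrtL X j) ^+ 2
  <= 144 * (p%:R * Num.sqrt p%:R * ln p%:R) :> R.
Proof.
move=> pP po np tX j0; have [_ _ _ [_ X0] _] := tX.
have principal (f : 'F_p -> R[i]) : mult_transform X f j = \sum_(x | x != 0) f x.
  rewrite /mult_transform (X0 j).1// [RHS]big_mkcond; apply: eq_bigr => x _.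
  by case: eqVneq; rewrite ?mulr1 ?mulr0.
set s : R := Num.sqrt _; set l : R := ln _.
have s1 : 1 <= s by rewrite -[leLHS]sqrtr1 ler_wsqrtr// ler1n prime_gt0.
have ss : s ^+ 2 = p%:R by rewrite sqr_sqrtr.
have l1 : 1 <= 2 * l by exact: one_le_double_ln (prime_gt1 pP).
have S_le : normc (mult_transform X (cubic_phase n) j) ^+ 2 <= 36 * p%:R.
  have -> : 36 * p%:R = (6 * s) ^+ 2 by rewrite exprMn ss -natrX.
  rewrite ler_pXn2r ?nnegrE ?normc_ge0//.
    by rewrite principal sum_unit_cubic_le// coprimez_Fp_neq0.
  by rewrite mulr_ge0// sqrtr_ge0.
have D_le : normc (sqrtL X j) ^+ 2 <= 1 + 2 * l.
  have -> : sqrtL X j = (\sum_(1 <= m < p) sqrt_weight m)%:C%C.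
    rewrite -sum_Fp_val ?sqrt_weight0// rmorph_sum /sqrtL principal big_mkcond.
    by apply: eq_bigr => x _; case: eqVneq => [->|//]; rewrite /= sqrt_weight0.
  rewrite normc_real -normrX ger0_norm ?sqr_ge0//.
  exact: sum_sqrt_weight_sqr_le (prime_gt0 pP).
apply: le_trans (ler_pM (sqr_ge0 _) (sqr_ge0 _) S_le D_le) _.
have pl0 : 0 <= p%:R * l by rewrite mulr_ge0//; lra.
have : p%:R * 1 <= p%:R * (2 * l) :> R by rewrite ler_wpM2l.
have : p%:R * l * 1 <= p%:R * l * s by rewrite ler_wpM2l.
rewrite mulrAC; lra.
Qed.

(** Replaces p - 1 by p and the truncated series by constC, at a relative cost of O(1 / p) each. *)
Lemma diagonal_constC (R : realType) (p : nat) : (1 < p)%N ->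
  `|p.-1%:R ^+ 2 * \sum_(1 <= m < p) sqr_coef m - constC * p%:R ^+ 2| <= 6 * p%:R :> R.
Proof.
move=> p1; have p0 : (0 < p)%N by exact: ltnW.
have p0' : (0 : R) < p%:R by rewrite ltr0n.
have [lo hi] := constC_bounds R p0; have /andP[C0 C2] := constC_ge0_le2 R.
set T := \sum_(_ <= _ < _) _ in lo hi *; set C := constC in lo hi C0 C2 *.
have pP : (p.-1%:R : R) = p%:R - 1 by rewrite -subn1 natrB.
have p1' : (1 : R) <= p%:R by rewrite ler1n.
have d0 : 0 <= C - T by lra.
have d1 : p%:R * (C - T) <= 2.
  by rewrite mulrC -ler_pdivlMr//; lra.
have P2 : p.-1%:R ^+ 2 <= p%:R * p%:R :> R by rewrite pP; nra.
have -> : p.-1%:R ^+ 2 * T - C * p%:R ^+ 2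
    = - (p.-1%:R ^+ 2 * (C - T) + C * (2 * p%:R - 1)).
  by rewrite pP; ring.
rewrite normrN ger0_norm; last first.
  by rewrite addr_ge0 ?mulr_ge0 ?sqr_ge0//; lra.
have : p.-1%:R ^+ 2 * (C - T) <= p%:R * p%:R * (C - T) by rewrite ler_wpM2r.
have : p%:R * (p%:R * (C - T)) <= p%:R * 2 by rewrite ler_wpM2l// ltW.
have : C * (2 * p%:R - 1) <= 2 * (2 * p%:R - 1) by rewrite ler_wpM2r//; lra.
rewrite mulrA; lra.
Qed.

Theorem theorem1p4 (R : realType) :
  exists c : R, forall (p : nat) (n : int) (a1 a2 : 'F_p),
    prime p -> odd p -> p = 1 %[mod 3] -> coprimez n p ->
    a1 ^+ 3 - 1 = 0 -> a2 ^+ 3 - 1 = 0 -> a1 != 1 -> a2 != 1 -> a1 != a2 ->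
    `| \sum_(chi \in nonprincipal_characters p)
          normc (cubic_sum p n chi) ^+ 2 * normc (dirichletL 1 chi)
       - constC * (1 + Csub (a1 : nat) + Csub (a1^-1 : nat)) * p%:R ^+ 2 |
    <= c * (p%:R `^ (3 / 2) * ln p%:R).
Proof.
exists 400 => p n a1 a2 pP po _ np /subr0_eq a13 _ a1N1 _ _.
have [X tX] := character_table_exists R pP.
have p0 : (0 : R) < p%:R by rewrite ltr0n prime_gt0.
set s : R := Num.sqrt p%:R; set l : R := ln p%:R.
have s1 : 1 <= s by rewrite -[leLHS]sqrtr1 ler_wsqrtr// ler1n prime_gt0.
have ss : s * s = p%:R by rewrite -expr2 sqr_sqrtr.
have l1 : 1 <= 2 * l by exact: one_le_double_ln (prime_gt1 pP).
have -> : p%:R `^ (3 / 2) = p%:R * s.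
  have -> : 3 / 2 = 1 + 2^-1 :> R by field.
  by rewrite powRD ?pnatr_eq0 -?lt0n ?prime_gt0 ?implybT// powRr1// powR12_sqrt.
have i13 : a1^-1 ^+ 3 = 1 by rewrite exprVn a13 invr1.
have i1N1 : a1^-1 != 1 by rewrite invr_eq1.
have Ca := Csub_cube_root_le R pP a13 a1N1.
have Ci := Csub_cube_root_le R pP i13 i1N1.
rewrite (sum_nonprincipal _ pP tX).
pose A j := normc (mult_transform X (cubic_phase n) j) ^+ 2.
pose L j := normc (dirichletL 1 (fun a => X j a%:R)).
pose D j := normc (sqrtL X j) ^+ 2.
under eq_bigr => j _ do rewrite cubic_sum_transform// -/(cubic_phase n) -/(A j) -/(L j).
have n0 : (0 < p.-1)%N by rewrite -ltnS prednK ?prime_gt1 ?prime_gt0.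
pose j0 := Ordinal n0.
(* The moment over all characters includes the principal one, which is removed here. *)
have splitD : \sum_j A j * D j = A j0 * D j0 + \sum_(j < p.-1 | (j : nat) != 0%N) A j * D j.
  by rewrite (bigD1 j0).
have E1 := approximation_moment pP po np tX.
have E2 := diagonal_moment pP po np tX.
have E3 := principal_moment_le pP po np tX (erefl : (j0 : nat) = 0%N).
have E4 := diagonal_constC R (prime_gt1 pP).
have /andP[C0 C2] := constC_ge0_le2 R.
have Ca0 := Csub_ge0 R (a1 : nat); have Ci0 := Csub_ge0 R (a1^-1 : 'F_p).
rewrite -/s -/l -!/(A _) -!/(D _) in E1 E2 E3 E4 Ca Ci.
have E5 : `|\sum_(j < p.-1 | (j : nat) != 0%N) A j * L j
    - \sum_(j < p.-1 | (j : nat) != 0%N) A j * D j|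
    <= 93 * (p%:R * s * l).
  apply: le_trans E1; rewrite -sumrB; apply: le_trans (ler_norm_sum _ _ _) _.
  apply: ler_sum => j _; rewrite -mulrBr normrM ger0_norm//; exact: sqr_ge0.
have E6 : constC * (Csub (a1 : nat) + Csub (a1^-1 : 'F_p)) * p%:R ^+ 2
    <= 32 * (p%:R * s * l).
  apply: (@le_trans _ _ (2 * (4 / s + 4 / s) * p%:R ^+ 2)).
    by rewrite ler_wpM2r ?sqr_ge0// ler_pM ?addr_ge0 ?lerD.
  have -> : 2 * (4 / s + 4 / s) * p%:R ^+ 2 = 16 * (p%:R * s).
    by rewrite -ss; field; rewrite gt_eqF//; lra.
  have : p%:R * s * 1 <= p%:R * s * (2 * l) by rewrite ler_wpM2l// mulr_ge0//; lra.
  lra.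
have E6' : 0 <= constC * (Csub (a1 : nat) + Csub (a1^-1 : 'F_p)) * p%:R ^+ 2 :> R.
  by rewrite !mulr_ge0 ?addr_ge0 ?sqr_ge0.
have AD0 : 0 <= A j0 * D j0 by rewrite mulr_ge0 ?sqr_ge0.
have p_le : p%:R <= 2 * (p%:R * s * l).
  have : p%:R * 1 <= p%:R * (s * (2 * l)) by rewrite ler_wpM2l ?(ltW p0)//; nra.
  lra.
rewrite splitD in E2.
move: E2 E4 E5; rewrite !ler_norml => /andP[E2a E2b] /andP[E4a E4b] /andP[E5a E5b].
by apply/andP; split; lra.
Qed.
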